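(* Let $n\ge1$, $N\ge2$, $q\in[0,1)$, and fix type counts $(N_1,\dots,N_n)$ with $N_m\ge1$ for all $m$ and $N_1+\dots+N_n\le N$. For $\eta\in\{0,\dots,n\}^N$ let $F_{\mathrm{alt}}(\eta)$ be the cylinder partition function with right boundary $\eta$ in which every vertex $(-m,j)$ carries the weight $w^{(-m),\mathrm{alt}}$. Then the random output $\eta$ of the alternative multiline queue algorithm with type counts $(N_1,\dots,N_n)$ has distribution $$\mathbb P(\eta)=\frac{F_{\mathrm{alt}}(\eta)}{\sum_{\eta'}F_{\mathrm{alt}}(\eta')},$$ for all $\eta$ with these type counts, the sum being over all $\eta'$ with these type counts.
   Context: **Alternative multiline queue algorithm.** One step for color $m$ takes a configuration $\eta\in\{0,m+1,\dots,n\}^N$ on the ring $\mathbb Z/N\mathbb Z$ with $N_i$ sites of color $i$ for each $i>m$, and produces a random $\eta'\in\{0,m,\dots,n\}^N$ with $N_i$ sites of color $i$, $i\ge m$, as follows. 1. Put $\eta'=(0,\dots,0)$ and sample a uniformly random subset $\mathcal J\subset\{1,\dots,N\}$ of cardinality $N_m+\dots+N_n$. 2. For $i=n,n-1,\dots,m+1$ in this order, process one after another the sites $a$ with $\eta_a=i$ (in increasing order). The path starting from $a$ visits the sites $a,a+1,a+2,\dots$ cyclically (starting with $a$ itself, going around arbitrarily many times); each time it visits a site $p\in\mathcal J$ with currently $\eta'_p=0$, it exits there with probability $1-q$ (then $\eta'_p:=i$ and its processing ends) and skips it with probability $q$, independently. (Equivalently, if $p_1,p_2,\dots,p_l$ are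 the currently unoccupied sites of $\mathcal J$ in cyclic order starting from $a$, inclusive, it exits at $p_t$ with probability proportional to $q^{t-1}$.) 3. Set $\eta'_p=m$ for the remaining unoccupied sites $p\in\mathcal J$. The full algorithm starts from the empty configuration and applies the steps for colors $n,n-1,\dots,1$ in this order, each with the output of the previous one as input (with fresh independent randomness); its output is the output of the step for color $1$. **Weights.** Fix $1\le m\le n$. Let $\mathbf A,\mathbf C$ be $n$-tuples with $A_m=C_m=+\infty$ and all other coordinates in $\mathbb Z_{\ge0}$; $\mathbf e_i$ standard basis vectors (adding or subtracting $\mathbf e_m$ changes nothing), $A_{[a,b]}=\sum_{i=a}^bA_i$ (zero if $a>b$). For $k\in\{0\}\cup\{m+1,\dots,n\}$ (color entering from the left, $0$ = none) and $\ell\in\{0,\dots,n\}$ (exiting right), $w^{(-m),\mathrm{alt}}(\mathbf A,k;\mathbf C,\ell)$ ($\mathbf A$ enters from below, $\mathbf C$ exits above) equals: - $1$ for $(\mathbf A,0;\mathbf A,0)$ and for $(\mathbf A,k;\mathbf A+\mathbf e_k,0)$, $k>m$; - $(1-q^{A_\ell})q^{A_{[\ell+1,n]}}$ for $(\mathbf A,0;\mathbf A-\mathbf e_\ell,\ell)$, $\ell>m$; - $q^{A_{[m+1,n]}}$ for $(\mathbf A,0;\mathbf A,m)$; - $q^{1+A_{[m+1,n]}}$ for $(\mathbf A,k;\mathbf A+\mathbf e_k,m)$, $k>m$; - $(1-q^{1+A_k})q^{A_{[k+1,n]}}$ for $(\mathbf A,k;\mathbf A,k)$, $k>m$; - $(1-q^{A_\ell})q^{A_{[\ell+1,n]}}$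 for $(\mathbf A,k;\mathbf A+\mathbf e_k-\mathbf e_\ell,\ell)$, $m<k<\ell$; - $(1-q^{A_\ell})q^{1+A_{[\ell+1,n]}}$ for $(\mathbf A,k;\mathbf A+\mathbf e_k-\mathbf e_\ell,\ell)$, $m<\ell<k$; and $0$ otherwise. **Cylinder partition function.** Vertices are $(-m,j)$, $1\le m\le n$, $j\in\mathbb Z/N\mathbb Z$. For $\eta\in\{0,\dots,n\}^N$ in which every color $1,\dots,n$ occurs, the partition function with right boundary $\eta$ is the (convergent) sum $$\sum\ \prod_{m=1}^n\prod_{j=1}^N w_{m,j}\bigl(\mathbf A^{(m,j)},h_{m+1,j};\mathbf A^{(m,j+1)},h_{m,j}\bigr),$$ where $w_{m,j}$ is the weight at $(-m,j)$, over all $h_{m,j}\in\{0,\dots,n\}$ with $h_{n+1,j}=0$, $h_{1,j}=\eta_j$, and all vertical tuples $\mathbf A^{(m,j)}$ ($j$ cyclic mod $N$) with $(\mathbf A^{(m,j)})_m=+\infty$, $(\mathbf A^{(m,j)})_i=0$ for $i<m$, $(\mathbf A^{(m,j)})_i\in\mathbb Z_{\ge0}$ for $i>m$. *)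

(* Defs.v *)
From HB Require Import structures.
From mathcomp Require Import all_boot all_order all_algebra.
From mathcomp Require Import all_classical all_reals all_analysis.

Set Implicit Arguments.
Unset Strict Implicit.
Unset Printing Implicit Defensive.

Import Order.TTheory GRing.Theory Num.Theory.
Import numFieldNormedType.Exports.

Local Open Scope ring_scope.

(* Colors are 0, ..., n, with 0 meaning "no particle"; the nonzero colors are
   the [lift ord0 i], of value i.+1, for i : 'I_n. Sites 1, ..., N of the ring
   Z/NZ are represented by 0, ..., N-1, with cyclic successor [ordS]. *)
Notation color n := 'I_n.+1.
Notation config n N := {ffun 'I_N -> color n}.

Definition empty_config n N : config n N := [ffun=> ord0].

Definition has_type_counts n N (Nc : 'I_n -> nat) (eta : config n N) : bool :=
  [forall i : 'I_n, #|[set j | eta j == lift ord0 i]| == Nc i].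

(* Laws of random elements of a finite type are given by their probability mass
   functions; [pbind] runs a second experiment, with fresh randomness, on the
   outcome of a first one. *)
Definition fpmf (R : realType) (T : finType) := T -> R.

Definition pret (R : realType) (T : finType) (x : T) : fpmf R T :=
  fun y => (y == x)%:R.

Definition pbind (R : realType) (T U : finType)
    (mu : fpmf R T) (f : T -> fpmf R U) : fpmf R U :=
  fun u => \sum_(t : T) mu t * f t u.

Definition uniform_subset (R : realType) (N k : nat) : fpmf R {set 'I_N} :=
  fun J => if #|J| == k then #|[set K : {set 'I_N} | #|K| == k]|%:R^-1 else 0.

Definition available n N (J : {set 'I_N}) (s : config n N) : pred 'I_N :=
  fun p => (p \in J) && (s p == ord0).

(* Probability that the path started at [a] exits at [p] upon its visit number
   [t] (counted from 0, so at the site a + t): all the available sites visited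
   earlier, counted with repetitions, have been skipped. *)
Definition exit_at (R : realType) (q : R) n N (J : {set 'I_N})
    (s : config n N) (a p : 'I_N) (t : nat) : R :=
  if (iter t (@ordS N) a == p) && available J s p
  then (1 - q) * q ^+ count (available J s) (traject (@ordS N) a t)
  else 0.

Definition exit_site (R : realType) (q : R) n N (J : {set 'I_N})
    (s : config n N) (a : 'I_N) : fpmf R 'I_N :=
  fun p => limn (series (exit_at q J s a p)).

Definition set_site n N (s : config n N) (p : 'I_N) (c : color n) :
    config n N :=
  [ffun x => if x == p then c else s x].

Definition place (R : realType) (q : R) n N (J : {set 'I_N}) (a : 'I_N)
    (c : color n) (s : config n N) : fpmf R (config n N) :=
  pbind (exit_site q J s a) (fun p => pret R (set_site s p c)).

Definition queue n N (m : color n) (eta : config n N) : seq 'I_N :=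
  flatten [seq [seq a <- enum 'I_N | eta a == i]
          | i : color n <- rev (enum 'I_n.+1) & (m < i)%N].

Definition process (R : realType) (q : R) n N (m : color n) (J : {set 'I_N})
    (eta : config n N) : fpmf R (config n N) :=
  foldl (fun mu a => pbind mu (place q J a (eta a)))
        (pret R (empty_config n N)) (queue m eta).

Definition fill n N (m : color n) (J : {set 'I_N}) (s : config n N) :
    config n N :=
  [ffun p => if available J s p then m else s p].

Definition mlq_step (R : realType) (q : R) n N (Nc : 'I_n -> nat)
    (m : color n) (eta : config n N) : fpmf R (config n N) :=
  pbind (@uniform_subset R N (\sum_(i < n | (m <= lift ord0 i)%N) Nc i)%N)
    (fun J => pbind (process q m J eta) (fun s => pret R (fill m J s))).

Definition alt_mlq (R : realType) (q : R) n N (Nc : 'I_n -> nat) :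
    fpmf R (config n N) :=
  foldl (fun mu i => pbind mu (mlq_step q Nc (lift ord0 i)))
        (pret R (empty_config n N)) (rev (enum 'I_n)).

(* n-tuples with coordinates in {0, 1, ..., +oo}, [None] being +oo. The
   coordinate of index i : 'I_n is the one of color i.+1. *)
Notation vtuple n := {ffun 'I_n -> option nat}.

(* A + e_k and A - e_k, with e_0 = 0. In [vdec], a coordinate equal to 0 is left
   unchanged; the weights below then vanish because of a factor 1 - q ^+ 0. *)
Definition vinc n (k : color n) (A : vtuple n) : vtuple n :=
  [ffun i => if lift ord0 i == k then omap succn (A i) else A i].

Definition vdec n (k : color n) (A : vtuple n) : vtuple n :=
  [ffun i => if lift ord0 i == k then omap predn (A i) else A i].

(* A_[a,b]; only used on ranges of colors with finite coordinates. *)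
Definition vsum n (A : vtuple n) (a b : nat) : nat :=
  (\sum_(i < n | a <= lift ord0 i <= b) odflt 0 (A i))%N.

(* The cases are mutually exclusive, since m > 0 in all uses. Left colors k with
   0 < k <= m, which never enter column -m, get weight 0. *)
Definition walt (R : realType) (q : R) n (m : color n)
    (A : vtuple n) (k : color n) (C : vtuple n) (l : color n) : R :=
  let mult c := vsum A c c in
  let above (c : color n) := vsum A c.+1 n in
  if [&& k == ord0, l == ord0 & C == A] then 1
  else if [&& (m < k)%N, l == ord0 & C == vinc k A] then 1
  else if [&& k == ord0, (m < l)%N & C == vdec l A] then
    (1 - q ^+ mult l) * q ^+ above l
  else if [&& k == ord0, l == m & C == A] then q ^+ above m
  else if [&& (m < k)%N, l == m & C == vinc k A] then q ^+ (1 + above m)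
  else if [&& (m < k)%N, l == k & C == A] then
    (1 - q ^+ (1 + mult k)) * q ^+ above k
  else if [&& (m < k)%N, (k < l)%N & C == vdec l (vinc k A)] then
    (1 - q ^+ mult l) * q ^+ above l
  else if [&& (m < l)%N, (l < k)%N & C == vdec l (vinc k A)] then
    (1 - q ^+ mult l) * q ^+ (1 + above l)
  else 0.

Definition vertical_ok n (m : color n) (A : vtuple n) : bool :=
  [forall i : 'I_n,
    if (lift ord0 i < m)%N then A i == Some 0%N
    else if lift ord0 i == m then A i == None
    else A i != None].

(* A state is a pair (h, V): [h c] is the row of horizontal colors h_{c+1,.}
   for 0 <= c <= n, and [V c j] is the vertical tuple A^{(c+1,j)} for c < n. *)
Notation cyl_state n N :=
  ({ffun 'I_n.+1 -> config n N} * {ffun 'I_n -> {ffun 'I_N -> vtuple n}})%type.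

Definition cyl_admissible n N (eta : config n N) : set (cyl_state n N) :=
  [set x : cyl_state n N | [/\ x.1 ord_max = empty_config n N, x.1 ord0 = eta &
    forall (c : 'I_n) (j : 'I_N), vertical_ok (lift ord0 c) (x.2 c j)]]%classic.

Definition cyl_weight (R : realType) (q : R) n N (x : cyl_state n N) : R :=
  \prod_(c < n) \prod_(j < N)
    walt q (lift ord0 c)
      (x.2 c j) (x.1 (lift ord0 c) j)
      (x.2 c (ordS j)) (x.1 (widen_ord (leqnSn n) c) j).

(* A sum of nonnegative terms over a countable set, a priori in [0, +oo]. *)
Definition Falt (R : realType) (q : R) n N (eta : config n N) : \bar R :=
  \esum_(x in cyl_admissible eta) (cyl_weight q x)%:E.

(* Main.v *)
(* In column -m the vertex weight is a product over the colors i > m: if b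
   particles of color i reach the vertex, the factor is 1 - q^b when i exits
   right, q^b when a color in {m, ..., i-1} exits right, and 1 otherwise. Hence
   a column is a product of one-color problems on the ring, each of them a sum
   over the number a >= 0 of particles crossing site 0. For one color, with
   entering sites S, exit sites T and u skipped sites, this sum Z satisfies

     (1 - q^u) Z(S + s, T) = (1 - q) \sum_(t in T) q^d(s,t) Z(S, T - t),

   d(s,t) being the number of skipped sites between s and t, because
   (1 - q) q^(b-1) = (1 - q^b) - (1 - q^(b-1)) telescopes along the ring started
   at s. Since the last of the particles, started at s, exits at t with
   probability (1 - q) q^d(s,t) / (1 - q^(u+1)), the law of the output of a step
   of the algorithm is the column partition function up to a constant depending
   only on the type counts; the columns are then composed. *)
Require Import Defs.
From mathcomp Require Import all_boot all_order all_algebra.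
From mathcomp Require Import all_classical all_reals all_analysis.
From mathcomp Require Import zify ring lra.

Set Implicit Arguments.
Unset Strict Implicit.
Unset Printing Implicit Defensive.

Import Order.TTheory GRing.Theory Num.Theory.
Import numFieldNormedType.Exports.

Local Open Scope classical_set_scope.
Local Open Scope ring_scope.

(** * One color in a column, along a list of sites *)

Section Column.
Variables (R : realType) (q : R) (T : eqType).
Implicit Types (x : T -> nat) (o s : pred T) (l : seq T) (p t : T).

(** The vertical configurations of a column are cut at site 0, while a particle may start anywhere.
    The identity for Z can be used at the starting site because Z does not depend on the cut:
    entries and exits balance on the ring, so the number of particles crossing one site determines
    the number crossing any other. The sum over a converges thanks to the sites of color m in the
    exiting row, which every color i > m skips: a single skipped site bounds the weight by q^(a-N).

    The order of processing decouples the colors. While color i is processed, only colors at least i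
    have been placed, so the free sites of the random subset are exactly those that count as skipped
    for i; they are filled later by lower colors or by m and stay skipped. A new particle therefore
    changes the factor of its own color only. Carrying (1 - q^u) Z instead of Z absorbs the
    denominators of the exit probabilities and gives the value 1 to a color without particles.

    The normalizing constant is never computed on the cylinder side: it is identified by the total
    mass 1 of the algorithm, which has to be proved because exit probabilities are limits of
    series. *)

Definition site_weight (b : nat) (o s : bool) : R :=
  if o then 1 - q ^+ b else if s then q ^+ b else 1.

Fixpoint col_weight x o s l (c : nat) : R :=
  if l is p :: l' then
    let b := (c + x p)%N in
    site_weight b (o p) (s p) * col_weight x o s l' (b - o p)
  else 1.

Fixpoint col_end x o l (c : nat) : nat :=
  if l is p :: l' then col_end x o l' (c + x p - o p) else c.

Lemma eq_col_weight x x' o o' s s' l c :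
  {in l, x =1 x'} -> {in l, o =1 o'} -> {in l, s =1 s'} ->
  col_weight x o s l c = col_weight x' o' s' l c.
Proof.
elim: l c => //= p l IH c ex eo es.
rewrite ex ?mem_head// eo ?mem_head// es ?mem_head//; congr (_ * _).
by apply: IH => t tl; [apply: ex|apply: eo|apply: es]; rewrite inE tl orbT.
Qed.

Lemma col_weight_cat x o s l1 l2 c :
  col_weight x o s (l1 ++ l2) c =
  col_weight x o s l1 c * col_weight x o s l2 (col_end x o l1 c).
Proof. by elim: l1 c => [|p l1 IH] c /=; rewrite ?mul1r// IH mulrA. Qed.

Lemma col_end_cat x o l1 l2 c :
  col_end x o (l1 ++ l2) c = col_end x o l2 (col_end x o l1 c).
Proof. by elim: l1 c => //=. Qed.

Lemma col_weight_nth p0 x o s l c :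
  col_weight x o s l c =
  \prod_(k < size l) site_weight (col_end x o (take k l) c + x (nth p0 l k))
                       (o (nth p0 l k)) (s (nth p0 l k)).
Proof.
elim: l c => [|p l IH] c /=; first by rewrite big_ord0.
by rewrite big_ord_recl /= IH.
Qed.

(* A particle exiting from an empty column would carry the weight
   1 - q ^+ 0 = 0, so truncated subtraction never breaks conservation. *)
Lemma col_end_conserve x o s l c : col_weight x o s l c != 0 ->
  (col_end x o l c + count o l = c + \sum_(p <- l) x p)%N.
Proof.
elim: l c => [|p l IH] c /=; first by rewrite big_nil.
rewrite mulf_eq0 negb_or => /andP[fac_neq0 /IH {}IH].
rewrite big_cons; move: IH fac_neq0; rewrite /site_weight.
case: (o p) => /=; last by lia.
by case: (c + x p)%N (addnA c (x p) (\sum_(j <- l) x j)) => [|b];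
   rewrite ?expr0 ?subrr ?eqxx//; lia.
Qed.

Lemma col_weight_deficit x o s l c :
  (c + \sum_(p <- l) x p < count o l)%N -> col_weight x o s l c = 0.
Proof.
by move=> h; apply/eqP; apply: contraTT h => /col_end_conserve; lia.
Qed.

Hypotheses (q_ge0 : 0 <= q) (q_lt1 : q < 1).

Lemma site_weight_ge0 b (o s : bool) : 0 <= site_weight b o s.
Proof.
rewrite /site_weight; case: o; first by rewrite subr_ge0 exprn_ile1// ltW.
by case: s => //; rewrite exprn_ge0.
Qed.

Lemma site_weight_le1 b (o s : bool) : site_weight b o s <= 1.
Proof.
rewrite /site_weight; case: o; first by rewrite gerBl exprn_ge0.
by case: s => //; rewrite exprn_ile1// ltW.
Qed.

Lemma col_weight_ge0 x o s l c : 0 <= col_weight x o s l c.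
Proof. by elim: l c => //= p l IH c; rewrite mulr_ge0// site_weight_ge0. Qed.

Lemma col_weight_le1 x o s l c : col_weight x o s l c <= 1.
Proof.
elim: l c => //= p l IH c.
by rewrite mulr_ile1// ?site_weight_ge0 ?col_weight_ge0// site_weight_le1.
Qed.

(** At a skipped site the factor is q^b, and at most [size l] particles have left before it, so b is
    at least c - [size l]; all other factors are at most 1. This decay makes the sum over crossing
    numbers converge. *)
Lemma col_weight_le x o s l c : has (fun p => s p && ~~ o p) l ->
  col_weight x o s l c <= q ^+ (c - size l).
Proof.
elim: l c => //= p l IH c /orP[/andP[sp nop]|hl].
  rewrite /site_weight (negPf nop) sp.
  apply: (@le_trans _ _ (q ^+ (c + x p))); last first.
    by apply: ler_wiXn2l; [exact: q_ge0|exact: ltW|lia].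
  by apply: ler_piMr; [exact: exprn_ge0|exact: col_weight_le1].
apply: (@le_trans _ _ (col_weight x o s l (c + x p - o p))).
  by apply: ler_piMl; [exact: col_weight_ge0|exact: site_weight_le1].
apply: (le_trans (IH _ hl)); apply: ler_wiXn2l; [exact: q_ge0|exact: ltW|].
by case: (o p); lia.
Qed.

(* Telescoping identity: (1 - q) q^b = (1 - q^(b+1)) - (1 - q^b). The exit
   at t is undone, which turns t into a skipped site. *)
Lemma col_weight_succ x o s l c : uniq l -> {in l, forall p, ~~ (o p && s p)} ->
  col_weight x o s l c.+1 =
  q ^+ count s l * col_weight x o s l c +
  (1 - q) * \sum_(t <- l | o t) q ^+ count s (take (index t l) l) *
     col_weight x (fun p => o p && (p != t)) (fun p => s p || (p == t)) l c.
Proof.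
elim: l c => [|p l IH] c; first by rewrite big_nil /= mulr0 addr0 mulr1.
move=> /= /andP[pl ul] disj.
have disjl : {in l, forall p, ~~ (o p && s p)}.
  by move=> t tl; apply: disj; rewrite inE tl orbT.
have neq_tl t : t \in l -> (p == t) = false.
  by move=> tl; apply: contraNF pl => /eqP ->.
set F := fun b t => q ^+ count s (take (index t l) l) *
     col_weight x (fun p => o p && (p != t)) (fun p => s p || (p == t)) l b.
have tailE : \sum_(t <- l | o t)
    q ^+ count s (take (if p == t then 0%N else (index t l).+1) (p :: l)) *
    (site_weight (c + x p) (o p && (p != t)) (s p || (p == t)) *
     col_weight x (fun p => o p && (p != t)) (fun p => s p || (p == t)) l
       (c + x p - (o p && (p != t))))
  = q ^+ s p * site_weight (c + x p) (o p) (s p) *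
    \sum_(t <- l | o t) F (c + x p - o p)%N t.
  rewrite big_distrr /= big_seq_cond [RHS]big_seq_cond; apply: eq_bigr => t.
  move=> /andP[tl _]; rewrite neq_tl//= andbT orbF exprD /F; ring.
have headE : o p -> col_weight x (fun p' => o p' && (p' != p))
    (fun p' => s p' || (p' == p)) l (c + x p) = col_weight x o s l (c + x p).
  move=> op; apply: eq_col_weight => // t tl;
    by rewrite eq_sym neq_tl ?andbT ?orbF.
rewrite big_cons tailE; case op: (o p) => /=; last first.
  rewrite !subn0 !addSn IH// /site_weight.
  by case: (s p) => /=; rewrite ?exprS ?exprD; ring.
have sp : s p = false by have := disj p (mem_head _ _); rewrite op; case: (s p).
rewrite !eqxx /= sp /= subn0 headE// /site_weight !expr0 !mul1r addSn.
rewrite subSS subn0.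
(* If no particle arrives at the exit site [p], the terms with the factor 1 - q^0 drop and only the
   summand t = p is left; otherwise the induction hypothesis applies with one particle less. *)
case: (c + x p)%N => [|b]; first by rewrite expr0 sub0n; ring.
by have := IH b ul disjl; rewrite -/(F b) subSS subn0 => ->; rewrite !exprS; ring.
Qed.

End Column.

(** * Series with vanishing first terms *)

Section SeriesShift.
Variables (R : realType).
Implicit Types (u : R ^nat).

Lemma cvg_series_shift u (k : nat) (S : R) : (forall b, (b < k)%N -> u b = 0) ->
  series (fun c => u (c + k)%N) @ \oo --> S <-> series u @ \oo --> S.
Proof.
move=> u0; have -> : series (fun c => u (c + k)%N) = (fun n => series u (n + k)%N).
  apply/funext => n; rewrite /series /= addnC.
  rewrite [RHS](@big_cat_nat _ _ _ k) ?leq_addr//=.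
  have -> : \sum_(0 <= i < k) u i = 0.
    by rewrite big_nat_cond big1// => i /andP[/andP[_ ik] _]; exact: u0.
  by rewrite add0r -{2}[k]add0n big_addn addKn.
by rewrite (cvg_shiftn k (series u) (nbhs S)).
Qed.

Lemma lim_series_shift u (k : nat) : (forall b, (b < k)%N -> u b = 0) ->
  cvgn (series u) -> limn (series (fun c => u (c + k)%N)) = limn (series u).
Proof.
by move=> u0 cu; apply/cvg_lim => //; apply/cvg_series_shift.
Qed.

Lemma cvg_seriesSP u : cvgn (series (fun c => u c.+1)) -> cvgn (series u).
Proof.
move=> cu; set v : R ^nat := fun c => if c is 0 then u 0%N else 0.
have -> : u = v + (u - v) by rewrite addrC subrK.
apply: is_cvg_seriesD.
  apply/cvg_ex; exists (u 0%N).
  rewrite -(cvg_shiftS (series v)).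
  have -> : [sequence series v n.+1]_n = (fun=> u 0%N); last exact: cvg_cst.
  apply/funext => n /=; rewrite /series /= big_nat_recl//= big1 ?addr0//.
case/cvg_ex: cu => S cu; apply/cvg_ex; exists S.
apply/(@cvg_series_shift _ 1); first by case=> //= _; rewrite !fctE subrr.
by under eq_fun do rewrite addn1 !fctE /= subr0.
Qed.

Lemma cvg_series_exprB (q : R) (k : nat) : 0 <= q -> q < 1 ->
  cvgn (series (fun c => q ^+ (c - k))).
Proof.
move=> q_ge0 q_lt1; elim: k => [|k IH]; last exact: cvg_seriesSP.
under eq_fun do rewrite subn0.
have := @is_cvg_geometric_series _ 1 q; rewrite ger0_norm// => /(_ q_lt1).
by rewrite /geometric/=; under eq_fun do rewrite mul1r.
Qed.

End SeriesShift.

(** * Summation over the number of particles crossing the cut *)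

Section ColumnSum.
Variables (R : realType) (q : R) (T : eqType).
Hypotheses (q_ge0 : 0 <= q) (q_lt1 : q < 1).
Implicit Types (x : T -> nat) (o s : pred T) (l : seq T) (p t : T).

Definition col_sum x o s l : R := limn (series (col_weight q x o s l)).

Lemma eq_col_sum x x' o o' s s' l :
  {in l, x =1 x'} -> {in l, o =1 o'} -> {in l, s =1 s'} ->
  col_sum x o s l = col_sum x' o' s' l.
Proof.
move=> ex eo es; rewrite /col_sum.
suff -> : col_weight q x o s l = col_weight q x' o' s' l by [].
by apply/funext => c; exact: eq_col_weight.
Qed.

Lemma is_cvg_col_weight x o s l : has (fun p => s p && ~~ o p) l ->
  cvgn (series (col_weight q x o s l)).
Proof.
move=> hs; apply: series_le_cvg (@cvg_series_exprB _ _ (size l) q_ge0 q_lt1).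
- by move=> c; exact: col_weight_ge0.
- by move=> c; exact: exprn_ge0.
- by move=> c; exact: col_weight_le.
Qed.

(** Moves the cut past [p]. Both sums are reindexed by the number b of particles present at [p]: b =
    c + [x p] when [p] comes first, and b = c + [o p], by the balance of entries and exits, when it
    comes last. The values of b missed by either shift have weight 0. *)
Lemma col_sum_rcons x o s p l : has (fun p => s p && ~~ o p) (p :: l) ->
  count o (p :: l) = (\sum_(t <- p :: l) x t)%N ->
  col_sum x o s (rcons l p) = col_sum x o s (p :: l).
Proof.
move=> hs; rewrite big_cons /= => bal.
pose G b := site_weight q b (o p) (s p) * col_weight q x o s l (b - o p).
have G0 b : (b < x p)%N || (b < o p)%N -> G b = 0.
  rewrite /G /site_weight; case op: (o p) bal => bal; last first.
    by rewrite orbF subn0 => bx; rewrite [X in _ * X]col_weight_deficit ?mulr0//; lia.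
  case: b => [_|b]; first by rewrite expr0 subrr mul0r.
  rewrite ltnS ltn0 orbF subn1 => bx.
  by rewrite [X in _ * X]col_weight_deficit ?mulr0//; lia.
have E1 : col_weight q x o s (p :: l) = (fun c => G (c + x p)%N).
  by apply/funext.
have E2 : col_weight q x o s (rcons l p) = (fun c => G (c + o p)%N).
  apply/funext => c; rewrite -cats1 col_weight_cat /= mulr1 /G addnK mulrC.
  have [->|nz] := eqVneq (col_weight q x o s l c) 0; first by rewrite !mulr0.
  by have := col_end_conserve nz => ce; congr (site_weight _ _ _ _ * _); lia.
have cG : cvgn (series G).
  have := @is_cvg_col_weight x _ _ _ hs; rewrite E1 => /cvg_ex[S cS].
  apply/cvg_ex; exists S; apply/(@cvg_series_shift _ _ (x p)) => // b bx.
  by rewrite G0// bx.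
rewrite /col_sum E1 E2 !lim_series_shift// => b h; apply: G0; rewrite h ?orbT//.
Qed.

(** An additional entry at the head [a] replaces c by c + 1. Since [x] has one entry too few for the
    exits, the term c = 0 vanishes and the shifted series has the same sum; [col_weight_succ] is
    then summed over c. *)
Lemma col_sum_insert x o s a l : uniq (a :: l) ->
  {in a :: l, forall p, ~~ (o p && s p)} -> has s (a :: l) ->
  count o (a :: l) = (\sum_(t <- a :: l) x t).+1 ->
  (1 - q ^+ count s (a :: l)) * col_sum (fun p => x p + (p == a))%N o s (a :: l) =
  (1 - q) * \sum_(t <- a :: l | o t)
     q ^+ count s (take (index t (a :: l)) (a :: l)) *
     col_sum x (fun p => o p && (p != t)) (fun p => s p || (p == t)) (a :: l).
Proof.
move=> ul disj hs cnt; set L := a :: l in ul disj hs cnt *.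
have hs' : has (fun p => s p && ~~ o p) L.
  case/hasP: hs => p pL sp; apply/hasP; exists p => //.
  by have := disj p pL; rewrite sp andbT => ->.
have hst t : has (fun p => (s p || (p == t)) && ~~ (o p && (p != t))) L.
  case/hasP: hs' => p pL /andP[sp op]; apply/hasP; exists p => //.
  by rewrite sp (negPf op).
have w0 : col_weight q x o s L 0 = 0.
  by apply: col_weight_deficit; rewrite cnt add0n.
have E : col_weight q (fun p => x p + (p == a))%N o s L =
    (fun c => col_weight q x o s L (c + 1)%N).
  apply/funext => c; rewrite /L /= eqxx addnA addnAC; congr (_ * _).
  apply: eq_col_weight => // t tl; case: eqP => [ta|_]; last by rewrite addn0.
  by move: ul; rewrite /L /= -ta tl.
have -> : col_sum (fun p => x p + (p == a))%N o s L = col_sum x o s L.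
  rewrite /col_sum E lim_series_shift//; last exact: is_cvg_col_weight.
  by case.
rewrite mulrBl mul1r; apply/eqP; rewrite subr_eq addrC; apply/eqP.
have {1}-> : col_sum x o s L = limn (series (fun c => col_weight q x o s L (c + 1)%N)).
  by rewrite lim_series_shift//; [case|exact: is_cvg_col_weight].
apply/cvg_lim => //.
under [X in series X]eq_fun do rewrite addn1 col_weight_succ//.
pose F t := (q ^+ count s (take (index t L) L)) *:
  col_weight q x (fun p => o p && (p != t)) (fun p => s p || (p == t)) L.
have cF (P : pred T) (r : seq T) :
    series (\sum_(t <- r | P t) F t) @ \oo --> \sum_(t <- r | P t)
     q ^+ count s (take (index t L) L) *
     col_sum x (fun p => o p && (p != t)) (fun p => s p || (p == t)) L.
  elim: r => [|t r IH].
    rewrite !big_nil (_ : series 0 = fun=> 0); first exact: cvg_cst.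
    by apply/funext => n; rewrite /series/= big1.
  rewrite !big_cons; case: ifP => // _.
  rewrite seriesD; apply: cvgD => //; rewrite seriesZ; apply: cvgZr.
  exact: is_cvg_col_weight.
have -> : (fun c => q ^+ count s L * col_weight q x o s L c +
    (1 - q) * \sum_(t <- L | o t) q ^+ count s (take (index t L) L) *
     col_weight q x (fun p => o p && (p != t)) (fun p => s p || (p == t)) L c) =
  (q ^+ count s L) *: col_weight q x o s L + (1 - q) *: (\sum_(t <- L | o t) F t).
  by apply/funext => c; rewrite !fctE fct_sumE.
rewrite seriesD !seriesZ; apply: cvgD; apply: cvgZr; last exact: cF.
exact: is_cvg_col_weight.
Qed.

End ColumnSum.

(** * Sums over the ring and exit probabilities *)

Section Ring.
Variable N : nat.
Implicit Types a p : 'I_N.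

Definition ring_from a : seq 'I_N := traject (@ordS N) a N.

Lemma val_iter_ordS a t : val (iter t (@ordS N) a) = ((a + t) %% N)%N.
Proof.
elim: t => [|t IH]; first by rewrite addn0 modn_small.
by rewrite iterS /= IH -addn1 modnDml addn1 addnS.
Qed.

Lemma iter_ordS_N a : iter N (@ordS N) a = a.
Proof. by apply: val_inj; rewrite val_iter_ordS modnDr modn_small. Qed.

Lemma ring_from_uniq a : uniq (ring_from a).
Proof.
apply/(uniqP a) => i j; rewrite !inE !size_traject => iN jN.
rewrite !nth_traject// => /(congr1 val); rewrite !val_iter_ordS => /eqP.
by rewrite eqn_modDl !modn_small// => /eqP.
Qed.

Lemma perm_ring_from a : perm_eq (ring_from a) (enum 'I_N).
Proof.
apply: uniq_perm; [exact: ring_from_uniq|exact: enum_uniq|].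
have sub : {subset ring_from a <= enum 'I_N} by move=> p _; rewrite mem_enum.
have sz : (size (enum 'I_N) <= size (ring_from a))%N.
  by rewrite size_traject size_enum_ord.
by have [_] := uniq_min_size (ring_from_uniq a) sub sz.
Qed.

Lemma mem_ring_from a p : p \in ring_from a.
Proof. by rewrite (perm_mem (perm_ring_from a)) mem_enum. Qed.

Lemma big_ring_from (V : Type) (idx : V) (op : Monoid.com_law idx)
    (P : pred 'I_N) (F : 'I_N -> V) a :
  \big[op/idx]_(p <- ring_from a | P p) F p = \big[op/idx]_(p | P p) F p.
Proof.
by rewrite (perm_big _ (perm_ring_from a)) big_enum_cond; apply: eq_bigl.
Qed.

Lemma count_ring_from (P : pred 'I_N) a : count P (ring_from a) = #|P|.
Proof. by rewrite -sum1_count big_ring_from sum1_card. Qed.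

Lemma ring_from_cons a : ring_from a = a :: behead (ring_from a).
Proof. by rewrite /ring_from; case: (N) a => [[]//|]. Qed.

Lemma ring_from_ordS a : ring_from (ordS a) = rcons (behead (ring_from a)) a.
Proof.
rewrite /ring_from; case: (N) a (iter_ordS_N a) => [[]//|n] a aN.
by rewrite trajectSr /= -iterSr aN.
Qed.

Lemma ring_from_ord0 (i0 : 'I_N) : i0 = 0%N :> nat -> enum 'I_N = ring_from i0.
Proof.
move=> i0E; apply: (@eq_from_nth _ i0); first by rewrite size_enum_ord size_traject.
move=> i; rewrite size_enum_ord => iN; apply: val_inj => /=.
by rewrite nth_traject// val_iter_ordS i0E add0n modn_small// nth_enum_ord.
Qed.

End Ring.

Section RingSum.
Variables (R : realType) (q : R) (N : nat).
Hypotheses (q_ge0 : 0 <= q) (q_lt1 : q < 1).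
Implicit Types (x : 'I_N -> nat) (o s : pred 'I_N) (a p : 'I_N).

Definition ring_sum x o s : R := col_sum q x o s (enum 'I_N).

(** Independence of the cut, by moving it one site at a time from site 0 to [a]. *)
Lemma ring_sum_from x o s a : (exists p, s p && ~~ o p) ->
  #|o| = (\sum_p x p)%N -> col_sum q x o s (ring_from a) = ring_sum x o s.
Proof.
move=> [p0 hs] bal; have N_gt0 : (0 < N)%N by case: (a) => i /(leq_ltn_trans (leq0n i)).
rewrite /ring_sum (@ring_from_ord0 _ (Ordinal N_gt0) erefl).
have -> : a = iter a (@ordS N) (Ordinal N_gt0).
  by apply: val_inj; rewrite val_iter_ordS add0n modn_small.
elim: (nat_of_ord a) => //= k <-.
set b := iter k _ _; rewrite ring_from_ordS.
have rE := ring_from_cons b.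
rewrite [in RHS]rE col_sum_rcons// -rE.
  by apply/hasP; exists p0 => //; exact: mem_ring_from.
by rewrite count_ring_from bal big_ring_from.
Qed.

Lemma ring_sum_insert x o s a : (forall p, ~~ (o p && s p)) ->
  (exists p, s p) -> #|o| = (\sum_p x p).+1 ->
  (1 - q ^+ #|s|) * ring_sum (fun p => x p + (p == a))%N o s =
  (1 - q) * \sum_(t | o t)
     q ^+ count s (take (index t (ring_from a)) (ring_from a)) *
     ring_sum x (fun p => o p && (p != t)) (fun p => s p || (p == t)).
Proof.
move=> disj [p0 sp0] cnt.
have rE := ring_from_cons a.
rewrite -(@ring_sum_from _ _ _ a); last 2 first.
- by exists p0; have := disj p0; rewrite sp0 andbT => ->.
- rewrite big_split /= cnt -addn1; congr addn.
  by rewrite (bigD1 a)//= eqxx big1// => i /negPf ->.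
rewrite -(count_ring_from s a) rE col_sum_insert//; last 3 first.
- by rewrite -rE ring_from_uniq.
- by rewrite -rE; apply/hasP; exists p0 => //; exact: mem_ring_from.
- by rewrite -rE count_ring_from cnt big_ring_from.
rewrite -rE big_ring_from.
congr (_ * _); apply: eq_bigr => t ot; rewrite ring_sum_from//.
  by exists p0; rewrite sp0/= negb_and; have := disj p0; rewrite sp0 andbT => ->.
have := cardD1 t o; rewrite cnt (_ : t \in o)// add1n => -[->].
by apply: eq_card => p; rewrite !inE andbC.
Qed.

(** All particles circulate forever: with c of them each skipped site contributes q^c, which leaves
    a geometric series of ratio [q ^+ #|s|]. *)
Lemma ring_sum_empty x o s : (0 < #|s|)%N -> (forall p, x p = 0%N) ->
  (forall p, ~~ o p) -> (1 - q ^+ #|s|) * ring_sum x o s = 1.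
Proof.
move=> s_gt0 x0 o0; set Q := q ^+ #|s|.
have Q_lt1 : `|Q| < 1 by rewrite ger0_norm ?exprn_ge0// exprn_ilt1// -lt0n.
have -> : ring_sum x o s = limn (series (geometric 1 Q)).
  congr (limn (series _)); apply/funext => c; rewrite /geometric /= mul1r /Q.
  have -> : #|s| = count s (enum 'I_N) by rewrite -sum1_count big_enum_cond -sum1_card.
  elim: (enum 'I_N) => [|p l IH] /=; first by rewrite expr0 expr1n.
  rewrite x0 (negPf (o0 p)) addn0 subn0 IH /site_weight exprD exprMn.
  by case: (s p); rewrite ?expr1 ?expr0 ?expr1n.
rewrite (cvg_lim _ (cvg_geometric_series Q_lt1))// mul1r divff// subr_eq0 eq_sym.
by apply: contraTneq Q_lt1 => ->; rewrite normr1 ltxx.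
Qed.

End RingSum.

(** * The exit law of a single particle *)

Section ExitSite.
Variables (R : realType) (q : R).
Hypotheses (q_ge0 : 0 <= q) (q_lt1 : q < 1).

(** The sum S satisfies S = A + Q S, where A is the sum over one period. Convergence comes from the
    bound A / (1 - Q) on the partial sums, by strong induction on their length. *)
Lemma lim_series_quasiperiodic (u : R ^nat) (N : nat) (Q : R) :
  (0 < N)%N -> 0 <= Q -> Q < 1 -> (forall t, 0 <= u t) ->
  (forall t, u (N + t)%N = Q * u t) ->
  limn (series u) = (\sum_(t < N) u t) / (1 - Q).
Proof.
move=> N_gt0 Q_ge0 Q_lt1 u_ge0 uN; set A := \sum_(t < N) u t.
have SN M : series u (N + M)%N = A + Q * series u M.
  rewrite /series /= (@big_cat_nat _ _ _ N) ?leq_addr//= big_mkord; congr (_ + _).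
  rewrite -{1}[N]add0n big_addn addKn mulr_sumr; apply: eq_bigr => i _.
  by rewrite addnC uN.
have nd : nondecreasing_seq (series u) by exact: nondecreasing_series.
have Q1 : 0 < 1 - Q by rewrite subr_gt0.
have A_ge0 : 0 <= A by exact: sumr_ge0.
have bnd M : series u M <= A / (1 - Q).
  have [k] := ubnP M; elim: k M => // k IH M.
  rewrite ltnS => Mk; have [NM|MN] := leqP N M.
    rewrite -(subnKC NM) SN.
    have : series u (M - N)%N <= A / (1 - Q) by apply: IH; lia.
    move/(ler_wpM2l Q_ge0) => h; apply: (le_trans (lerD (lexx A) h)).
    by rewrite le_eqVlt; apply/orP; left; apply/eqP; field; lra.
  apply: (@le_trans _ _ A).
    have -> : A = series u N by rewrite /series /= big_mkord.
    by apply: nd; exact: ltnW.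
  by rewrite ler_pdivlMr//; apply: ler_piMr => //; lra.
have cu : cvgn (series u).
  by apply: nondecreasing_is_cvgn => //; exists (A / (1 - Q)) => _ [M _ <-].
have : limn (series u) = A + Q * limn (series u).
  apply/cvg_lim => //; rewrite -(cvg_shiftn N (series u)).
  under eq_fun do rewrite addnC SN.
  by apply: cvgD; [exact: cvg_cst|apply: cvgMr].
move: (limn _) => S SE; apply: (canRL (mulfK _)); first by rewrite gt_eqF.
lra.
Qed.

Variables (n N : nat).
Implicit Types (J : {set 'I_N}) (s : config n N) (a p : 'I_N).

(** A full turn skips every available site once and multiplies the weights by q to their number;
    within one turn a single visit reaches [p]. Summing over the turns produces the denominator. *)
Lemma exit_siteE J s a p : (0 < #|available J s|)%N ->
  exit_site q J s a p = if available J s p then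
    (1 - q) * q ^+ count (available J s) (take (index p (ring_from a)) (ring_from a))
      / (1 - q ^+ #|available J s|)
  else 0.
Proof.
move=> av_gt0; set P := available J s.
have N_gt0 : (0 < N)%N by case: (a) => i /(leq_ltn_trans (leq0n i)).
rewrite /exit_site (@lim_series_quasiperiodic _ N (q ^+ #|P|))//; last 4 first.
- exact: exprn_ge0.
- by rewrite exprn_ilt1// -lt0n.
- move=> t; rewrite /exit_at; case: ifP => // _.
  by rewrite mulr_ge0 ?exprn_ge0// subr_ge0 ltW.
- move=> t; rewrite /exit_at addnC iterD iter_ordS_N addnC trajectD iter_ordS_N.
  rewrite count_cat.
  rewrite -/(ring_from a) count_ring_from exprD.
  by case: ifP => _; rewrite ?mulr0//; ring.
have ip : (index p (ring_from a) < N)%N.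
  by have := mem_ring_from a p; rewrite -index_mem size_traject.
have iterP t : (t < N)%N -> (iter t (@ordS N) a == p) = (t == index p (ring_from a)).
  move=> tN; rewrite -(@nth_traject _ (@ordS N) t N)//.
  apply/eqP/eqP => [<-|->]; last by rewrite nth_index// mem_ring_from.
  by rewrite index_uniq ?size_traject// ring_from_uniq.
rewrite (bigD1 (Ordinal ip))//= big1 ?addr0; last first.
  by move=> t tip; rewrite /exit_at iterP// (negPf (_ : _ != _)).
rewrite /exit_at iterP// eqxx /= -/P; case: ifP => _; last by rewrite mul0r.
congr (_ * q ^+ _ / _); congr count.
by rewrite /ring_from take_traject// ltnW.
Qed.

(** Telescoping: a site of [P] preceded by k others contributes q^k - q^(k+1). *)
Lemma sum_expr_count (T : eqType) (P : pred T) (l : seq T) : uniq l ->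
  \sum_(p <- l | P p) (1 - q) * q ^+ count P (take (index p l) l) =
  1 - q ^+ count P l.
Proof.
elim: l => [|p l IH]; first by rewrite big_nil /= expr0 subrr.
move=> /= /andP[pl ul]; rewrite big_cons eqxx /= expr0 mulr1.
have -> : \sum_(j <- l | P j) (1 - q) *
   q ^+ count P (take (if p == j then 0%N else (index j l).+1) (p :: l)) =
   q ^+ P p * (1 - q ^+ count P l).
  rewrite -(IH ul) mulr_sumr big_seq_cond [RHS]big_seq_cond; apply: eq_bigr => j.
  move=> /andP[jl _]; have -> : (p == j) = false by apply: contraNF pl => /eqP ->.
  by rewrite /= exprD; ring.
by case: (P p); rewrite exprD; ring.
Qed.

Lemma exit_site_mass J s a : (0 < #|available J s|)%N ->
  \sum_p exit_site q J s a p = 1.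
Proof.
move=> av_gt0; under eq_bigr do rewrite exit_siteE//.
rewrite -big_mkcond /= -mulr_suml -(big_ring_from _ _ _ a).
rewrite sum_expr_count ?ring_from_uniq//.
rewrite count_ring_from divff// subr_eq0 eq_sym.
by rewrite lt_eqF// exprn_ilt1// -lt0n.
Qed.

End ExitSite.

(** * The law of the configuration while particles are placed *)

Section Process.
Variables (R : realType) (q : R) (n N : nat).
Hypotheses (q_ge0 : 0 <= q) (q_lt1 : q < 1).
Implicit Types (J : {set 'I_N}) (s eta : config n N) (a p : 'I_N) (i c : color n)
  (w : seq 'I_N).

Definition entries eta w i p : nat := count (fun a => (a == p) && (eta a == i)) w.

(** Empty sites of [J] are included, since they end up with a color below [i]. The set is thus
    unaffected by the later placement of lower colors. *)
Definition skipped J s i : pred 'I_N := fun p => (p \in J) && (s p < i)%N.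

Definition has_color s i : pred 'I_N := fun p => s p == i.

Definition color_sum J s eta w i : R :=
  ring_sum q (entries eta w i) (has_color s i) (skipped J s i).

(** The law of the configuration after the particles of [w] have exited is carried by these [s]. *)
Definition placed J eta w s : bool :=
  [forall p, (s p != ord0) ==> (p \in J)] &&
  [forall i : 'I_n, #|has_color s (lift ord0 i)| ==
                    count (fun a => eta a == lift ord0 i) w].

Lemma sum_entries eta w i :
  (\sum_p entries eta w i p)%N = count (fun a => eta a == i) w.
Proof.
elim: w => [|a w IH] /=; first by rewrite big1.
rewrite big_split /= -IH; congr addn; rewrite (bigD1 a)//= eqxx big1 ?addn0//.
by move=> p /negPf; rewrite eq_sym => ->.
Qed.

Lemma card_has_color_sum s :
  (\sum_(i < n) #|has_color s (lift ord0 i)|)%N = #|[pred p | s p != ord0]|.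
Proof.
rewrite -sum1_card (partition_big s (fun i => i != ord0))//=.
rewrite [RHS]big_mkcond big_ord_recl /= add0n; apply: eq_bigr => i _.
rewrite -sum1_card; apply: eq_bigl => p; rewrite unfold_in /has_color.
by rewrite inE; case: (eqVneq (s p) (lift ord0 i)) => [->|]; rewrite ?andbF.
Qed.

Lemma card_available J eta w s : placed J eta w s ->
  all (fun a => eta a != ord0) w -> (#|available J s| + size w = #|J|)%N.
Proof.
move=> /andP[/forallP sJ /forallP cnt] wpos.
have -> : size w = #|[pred p | s p != ord0]|.
  rewrite -card_has_color_sum; under eq_bigr do rewrite (eqP (cnt _)).
  elim: w {cnt} wpos => [|a w IH] /=; first by rewrite big1.
  move=> /andP[a0 /IH {}IH]; rewrite big_split /= -IH -add1n; congr addn.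
  case: (unliftP ord0 (eta a)) a0 => [i ->|->]; rewrite ?eqxx// => _.
  by rewrite (bigD1 i)//= eqxx big1 ?addn0// => j ji;
    rewrite (inj_eq lift_inj) eq_sym (negPf ji).
rewrite -(cardID [pred p | s p == ord0] J); congr addn; apply: eq_card => p.
rewrite !inE; have := sJ p; by case: (s p == ord0); case: (p \in J).
Qed.

Lemma available_skipped J s i p : i != ord0 -> available J s p -> skipped J s i p.
Proof. by move=> i0 /andP[pJ /eqP sp]; rewrite /skipped pJ sp lt0n. Qed.

(** Colors whose particles are not yet processed contribute the factor 1 to the invariant of
    [processE]. *)
Lemma color_sum_empty J eta w s (i : 'I_n) : placed J eta w s ->
  (0 < #|available J s|)%N -> all (fun a => eta a != lift ord0 i) w ->
  (1 - q ^+ #|skipped J s (lift ord0 i)|) * color_sum J s eta w (lift ord0 i) = 1.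
Proof.
move=> /andP[_ /forallP cnt] av wi; have cw P :
    {subset P <= [pred a | eta a == lift ord0 i]} -> count P w = 0%N.
  move=> sub; apply/eqP; rewrite -leqn0 leqNgt -has_count; apply/hasP => -[a aw Pa].
  by have := allP wi a aw; have := sub a Pa; rewrite inE => ->.
apply: ring_sum_empty => //.
- apply: leq_trans av _; apply: subset_leq_card; apply/fintype.subsetP => p.
  exact: available_skipped.
- by move=> p; apply: cw => a /andP[_].
- move=> p; apply/negP => sp; have := cnt i; rewrite [X in _ == X]cw//.
  by rewrite -leqn0 leqNgt; move/negP; apply; apply/card_gt0P; exists p.
Qed.

Lemma exit_site_unavailable J s a p : ~~ available J s p -> exit_site q J s a p = 0.
Proof.
move=> /negPf nav; rewrite /exit_site (_ : series _ = fun=> 0); first exact: lim_cst.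
by apply/funext => k; rewrite /series /= big1// => t _; rewrite /exit_at nav andbF.
Qed.

Lemma set_siteK s p c : s p = c -> set_site (set_site s p ord0) p c = s.
Proof. by move=> sp; apply/ffunP => x; rewrite !ffunE; case: eqP => // ->. Qed.

(* The last particle to exit sits at a site [p] of color [c]; before that, the
   configuration was [s] with [p] cleared. *)
Lemma pbind_place J a c (mu : fpmf R (config n N)) s :
  pbind mu (place q J a c) s = \sum_(p | (s p == c) && (p \in J))
    mu (set_site s p ord0) * exit_site q J (set_site s p ord0) a p.
Proof.
rewrite /pbind /place; under eq_bigr do rewrite mulr_sumr.
rewrite exchange_big /= [RHS]big_mkcond /=; apply: eq_bigr => p _.
rewrite /pret (bigD1 (set_site s p ord0))//= big1 ?addr0 => [|t ts].
  case: (boolP (p \in J)) => pJ; last first.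
    rewrite andbF exit_site_unavailable ?mul0r ?mulr0//.
    by rewrite /available negb_and pJ.
  rewrite andbT; have [sp|sp] := eqVneq (s p) c.
    by rewrite set_siteK// eqxx mulr1.
  rewrite [_ == _](negbTE _) ?mulr0//; apply: contraNneq sp => ->.
  by rewrite !ffunE eqxx.
have [tp|tp] := eqVneq (t p) ord0; last first.
  by rewrite exit_site_unavailable ?mul0r ?mulr0// /available negb_and tp orbT.
rewrite [s == _](negbTE _) ?mulr0//; apply: contraNneq ts => ->.
by apply/eqP/ffunP => x; rewrite !ffunE; case: eqP => // ->.
Qed.

Lemma placed_rcons J eta w a s p : eta a != ord0 -> p \in J -> s p = eta a ->
  placed J eta (rcons w a) s = placed J eta w (set_site s p ord0).
Proof.
move=> a0 pJ sp; congr (_ && _).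
  apply: eq_forallb => x; rewrite !ffunE; case: (eqVneq x p) => [->|//].
  by rewrite pJ !implybT.
apply: eq_forallb => i; rewrite -cats1 count_cat /= addn0.
rewrite (cardD1 p) (_ : (p \in _) = (eta a == lift ord0 i)); last first.
  by rewrite -sp.
rewrite addnC eqn_add2r; congr (_ == _); apply: eq_card => x.
rewrite inE 2!unfold_in /has_color ffunE.
by case: (eqVneq x p).
Qed.

Lemma skipped_clear J s p i : p \in J -> i != ord0 ->
  skipped J (set_site s p ord0) i =1 [pred x | skipped J s i x || (x == p)].
Proof.
move=> pJ i0 x; rewrite /skipped /= !ffunE; case: (eqVneq x p) => [->|_].
  by rewrite pJ lt0n i0 orbT.
by rewrite orbF.
Qed.

Lemma has_color_clear s p i : i != ord0 ->
  has_color (set_site s p ord0) i =1 [pred x | has_color s i x && (x != p)].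
Proof.
move=> i0 x; rewrite /has_color /= !ffunE; case: (eqVneq x p) => [->|_].
  by rewrite eq_sym (negPf i0) andbF.
by rewrite andbT.
Qed.

Lemma eq_ring_sum (x x' : 'I_N -> nat) (o o' s s' : pred 'I_N) :
  x =1 x' -> o =1 o' -> s =1 s' ->
  ring_sum q x o s = ring_sum q x' o' s'.
Proof. by move=> ex eo es; apply: eq_col_sum => t _. Qed.

(** The identity [ring_sum_insert] read as a recursion for the law: clearing [p] adds one skipped
    site, and the resulting factor 1 - q^(u+1) cancels the denominator of the exit probability. *)
Lemma color_sum_rcons J eta w a s (c : 'I_n) : eta a = lift ord0 c ->
  pairwise (fun a b => (eta b <= eta a)%N) (rcons w a) ->
  placed J eta (rcons w a) s -> (0 < #|available J s|)%N ->
  (1 - q ^+ #|skipped J s (eta a)|) * color_sum J s eta (rcons w a) (eta a) =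
  \sum_(p | (s p == eta a) && (p \in J))
     (1 - q ^+ #|skipped J (set_site s p ord0) (eta a)|) *
     color_sum J (set_site s p ord0) eta w (eta a) *
     exit_site q J (set_site s p ord0) a p.
Proof.
move=> ac; rewrite pairwise_rcons => /andP[wa _] pl av.
have a0 : eta a != ord0 by rewrite ac.
have [/forallP sJ /forallP cnt] := andP pl.
have xE : entries eta (rcons w a) (eta a) =1
    (fun p => entries eta w (eta a) p + (p == a))%N.
  by move=> p; rewrite /entries -cats1 count_cat /= eqxx andbT addn0 eq_sym.
rewrite /color_sum (eq_ring_sum xE (frefl _) (frefl _)) ring_sum_insert//; first last.
- have := cnt c; rewrite -ac => /eqP ->.
  by rewrite sum_entries -cats1 count_cat /= eqxx addn1.
- by case/card_gt0P: av => p /(available_skipped a0); exists p.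
- by move=> p; rewrite /skipped /has_color; case: eqP => // ->; rewrite ltnn andbF.
rewrite mulr_sumr.
have JE p : (s p == eta a) && (p \in J) = has_color s (eta a) p.
  rewrite /has_color andb_idr// => /eqP sp.
  by have := sJ p; rewrite sp a0.
rewrite (eq_bigl _ _ JE); apply: eq_bigr => p; rewrite -JE => /andP[/eqP sp pJ].
have pl' : placed J eta w (set_site s p ord0) by rewrite -(placed_rcons _ a0 pJ sp).
(* Colors are processed in decreasing order, so no site carries a nonzero color below [eta a] before
   this exit: being skipped for [eta a] means being empty. *)
have avE : available J (set_site s p ord0) =1 skipped J (set_site s p ord0) (eta a).
  move=> x; rewrite /available /skipped; congr (_ && _).
  set t := set_site s p ord0 in pl' *.
  case: (unliftP ord0 (t x)) => [i ti|->]; last by rewrite eqxx lt0n.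
  rewrite ti; apply/esym; rewrite ltnNge (_ : (eta a <= _)%N)// leqNgt.
  apply/negP => ia; case/andP: pl' => _ /forallP/(_ i)/eqP.
  rewrite [RHS](_ : _ = 0%N); last first.
    apply/eqP; rewrite -leqn0 leqNgt -has_count; apply/hasPn => b bw.
    apply: contraTneq ia => <-; rewrite -leqNgt; exact: (allP wa).
  move/eqP; rewrite -leqn0 leqNgt => /negP; apply.
  by apply/card_gt0P; exists x; apply/eqP.
have av' : (0 < #|available J (set_site s p ord0)|)%N.
  by apply/card_gt0P; exists p; rewrite unfold_in /available pJ !ffunE !eqxx.
rewrite exit_siteE// /available pJ !ffunE !eqxx /= -/(available _ _).
rewrite (eq_card avE) (eq_count avE).
rewrite (eq_ring_sum (frefl _) (has_color_clear s p a0) (skipped_clear s pJ a0)).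
(* Clearing [p] affects no site strictly before [p] on the path from [a]. *)
rewrite (_ : count (skipped J (set_site s p ord0) (eta a)) _ =
  count (skipped J s (eta a)) (take (index p (ring_from a)) (ring_from a))); last first.
  apply: eq_in_count => x xt; rewrite (skipped_clear s pJ a0) /=.
  have -> : (x == p) = false; last by rewrite orbF.
  apply/negP => /eqP xp; move: xt; rewrite xp.
  by rewrite in_take ?mem_ring_from// ltnn.
set k := #|_|; have : 1 - q ^+ k != 0; last by move=> ?; field.
by rewrite subr_eq0 eq_sym lt_eqF// exprn_ilt1// -lt0n /k -(eq_card avE).
Qed.

(** Induction on the processed particles, conditioning on the exit site [p] of the last one. Only
    the factor of its color changes: lower colors contribute 1 before and after, and for a higher
    color [p] is skipped whether empty or occupied. The bound on [size w] keeps a site available, so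
    no denominator vanishes. *)
Lemma processE (m : color n) J eta w s :
  pairwise (fun a b => (eta b <= eta a)%N) w ->
  all (fun a => (m < eta a)%N) w -> (size w < #|J|)%N ->
  foldl (fun mu a => pbind mu (place q J a (eta a)))
        (pret R (empty_config n N)) w s =
  if placed J eta w s then
    \prod_(i < n | (m < lift ord0 i)%N)
      ((1 - q ^+ #|skipped J s (lift ord0 i)|) * color_sum J s eta w (lift ord0 i))
  else 0.
Proof.
elim/last_ind: w s => [|w a IH] s.
  move=> _ _ J_gt0 /=; rewrite /pret.
  have -> : (s == empty_config n N) = placed J eta [::] s.
    apply/eqP/idP => [->|/andP[_ /forallP cnt]].
      apply/andP; split; first by apply/forallP => p; rewrite ffunE eqxx.
      by apply/forallP => i; rewrite eq_card0// => p; rewrite unfold_in /has_color ffunE.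
    apply/ffunP => p; rewrite ffunE; case: (unliftP ord0 (s p)) => // i si.
    by have /eqP/card0_eq/(_ p) := cnt i; rewrite unfold_in /has_color si eqxx.
  case: ifP => // pl; rewrite big1// => i _; rewrite color_sum_empty//.
  by have := card_available pl isT; rewrite addn0 => ->.
rewrite foldl_rcons all_rcons size_rcons => pw /andP[ma mw] wJ.
have [pw' wa] : pairwise (fun a b => (eta b <= eta a)%N) w /\
    all (fun b => (eta a <= eta b)%N) w.
  by move: pw; rewrite pairwise_rcons => /andP[].
have [c ac|a0] := unliftP ord0 (eta a); last by move: ma; rewrite a0.
have a0 : eta a != ord0 by rewrite ac.
have w0 : all (fun b => eta b != ord0) w.
  by apply: sub_all mw => b mb; rewrite -lt0n; apply: leq_ltn_trans mb.
rewrite pbind_place; under eq_bigr => p /andP[/eqP sp pJ].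
  rewrite IH// ?(ltnW wJ)// -(placed_rcons _ a0 pJ sp); over.
case: ifP => pl; last by rewrite big1// => p _; rewrite mul0r.
have av : (0 < #|available J s|)%N.
  rewrite -(ltn_add2r (size (rcons w a))) add0n (card_available pl) ?size_rcons//.
  by rewrite all_rcons a0.
have mc : (m < lift ord0 c)%N by rewrite -ac.
rewrite [RHS](bigD1 c mc) -ac /= (color_sum_rcons ac pw pl av) mulr_suml.
apply: eq_bigr => p /andP[/eqP sp pJ]; rewrite (bigD1 c mc) -ac /= mulrAC.
congr (_ * _); apply: eq_bigr => i /andP[mi ic].
have pl' : placed J eta w (set_site s p ord0) by rewrite -(placed_rcons _ a0 pJ sp).
have aci : eta a != lift ord0 i by rewrite ac (inj_eq lift_inj) eq_sym.
have [ia|ai] := ltnP (lift ord0 i) (eta a).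
  rewrite !color_sum_empty//.
  - by rewrite all_rcons aci /=; apply: sub_all wa => b ab;
      apply: contraTneq ia => <-; rewrite -leqNgt.
  - by rewrite -(ltn_add2r (size w)) add0n (card_available pl' w0) ltnW.
  - by apply: sub_all wa => b ab; apply: contraTneq ia => <-; rewrite -leqNgt.
have skE : skipped J (set_site s p ord0) (lift ord0 i) =1 skipped J s (lift ord0 i).
  move=> x; rewrite skipped_clear//= orb_idr// => /eqP ->.
  by rewrite /skipped pJ sp ltn_neqAle ai andbT.
rewrite (eq_card skE); congr (_ * _); apply: eq_ring_sum => // x.
  by rewrite /entries -cats1 count_cat /= (negPf aci) andbF !addn0.
rewrite has_color_clear//= andb_idr// => /eqP sx; apply: contraNneq aci => xp.
by rewrite -sp -xp sx.
Qed.

(** Each exit law has mass 1 only if a site is available. [processE] supplies this: the law vanishes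
    outside [placed], where the available sites can be counted. *)
Lemma process_mass (m : color n) J eta w :
  pairwise (fun a b => (eta b <= eta a)%N) w ->
  all (fun a => (m < eta a)%N) w -> (size w < #|J|)%N ->
  \sum_s foldl (fun mu a => pbind mu (place q J a (eta a)))
        (pret R (empty_config n N)) w s = 1.
Proof.
elim/last_ind: w => [|w a IH].
  move=> _ _ _ /=; rewrite /pret (bigD1 (empty_config n N))//= eqxx.
  by rewrite big1 ?addr0// => s /negPf ->.
rewrite all_rcons size_rcons => pw /andP[ma mw] wJ.
have pw' : pairwise (fun a b => (eta b <= eta a)%N) w.
  by move: pw; rewrite pairwise_rcons => /andP[].
have w0 : all (fun b => eta b != ord0) w.
  by apply: sub_all mw => b mb; rewrite -lt0n; apply: leq_ltn_trans mb.
rewrite foldl_rcons -[RHS](IH pw' mw (ltnW wJ)) exchange_big /=.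
apply: eq_bigr => s _; rewrite -mulr_sumr.
have [pl|npl] := boolP (placed J eta w s); last first.
  by rewrite (processE (m := m))// ?(ltnW wJ)// (negPf npl) mul0r.
rewrite exchange_big /=; under eq_bigr => p _.
  rewrite -mulr_sumr /pret (bigD1 (set_site s p (eta a)))//= eqxx big1 ?addr0 ?mulr1;
    last by move=> t /negPf ->.
  over.
rewrite exit_site_mass ?mulr1//.
by rewrite -(ltn_add2r (size w)) add0n (card_available pl w0) ltnW.
Qed.

End Process.

(** * One step of the algorithm *)

Section Queue.
Variables (n N : nat).
Implicit Types (m : color n) (u : config n N).

Lemma queue_all m u : all (fun a => (m < u a)%N) (queue m u).
Proof.
apply/allP => a /flattenP[_ /mapP[i + ->]].
by rewrite !mem_filter => /andP[mi _] /andP[/eqP ->].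
Qed.

Lemma queue_pairwise m u : pairwise (fun a b => (u b <= u a)%N) (queue m u).
Proof.
have flat cs : pairwise (fun i j : color n => (j <= i)%N) cs ->
    pairwise (fun a b => (u b <= u a)%N)
      (flatten [seq [seq a <- enum 'I_N | u a == i] | i : color n <- cs]).
  elim: cs => //= i cs IH /andP[ics /IH pcs]; rewrite pairwise_cat pcs andbT.
  apply/andP; split.
    apply/allrelP => a b; rewrite mem_filter => /andP[/eqP -> _].
    move=> /flattenP[_ /mapP[j jcs ->]]; rewrite mem_filter => /andP[/eqP -> _].
    exact: (allP ics).
  elim: (enum 'I_N) => //= a l IHl; case: eqP => //= ai; rewrite IHl andbT.
  by apply/allP => b; rewrite mem_filter => /andP[/eqP -> _]; rewrite ai.
apply/flat/pairwise_filter; rewrite -sorted_pairwise; last first.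
  by move=> j i k /= ji kj; exact: leq_trans kj ji.
rewrite rev_sorted; have := iota_sorted 0 n.+1; rewrite -val_enum_ord.
by rewrite sorted_map.
Qed.

Lemma count_queue m u (P : pred 'I_N) :
  count P (queue m u) = #|[pred a | P a && (m < u a)%N]|.
Proof.
rewrite -sum1_count big_flatten /= big_map big_filter big_rev /= -[RHS]sum1_card.
rewrite (partition_big u (fun i => m < i)%N) => [|a /andP[]//].
rewrite big_enum_cond /=; apply: eq_big => // i mi.
rewrite big_filter_cond big_enum_cond /=; apply: eq_bigl => a.
by rewrite !inE; case: eqP => [->|_]; rewrite ?andbF// mi !andbT.
Qed.

End Queue.

Section Step.
Variables (R : realType) (q : R) (n N : nat) (Nc : 'I_n -> nat).
Hypotheses (q_ge0 : 0 <= q) (q_lt1 : q < 1) (Nc_ge1 : forall i : 'I_n, (1 <= Nc i)%N)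
  (Nc_sum : (\sum_(i < n) Nc i <= N)%N).
Implicit Types (u v s : config n N) (J : {set 'I_N}) (c i : 'I_n).

(** Colors are shifted by one with respect to [i]: exactly the colors r + 1, ..., n occur. The step
    for color c + 1 goes from [c.+1] to [c]. *)
Definition row_counts (r : nat) v : bool :=
  [forall i : 'I_n, #|has_color v (lift ord0 i)| == if (r <= i)%N then Nc i else 0%N].

Lemma row_countsP r v : reflect
  (forall i, #|has_color v (lift ord0 i)| = if (r <= i)%N then Nc i else 0%N)
  (row_counts r v).
Proof. by apply: (iffP forallP) => h i; apply/eqP. Qed.

Definition row_sum (m : color n) u v (i : color n) : R :=
  ring_sum q (fun p => u p == i) (has_color v i)
    (fun p => (m <= v p)%N && (v p < i)%N).

(** Partition function of one column between the rows [u] and [v], summed over the crossing numbers.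
    The restriction on type counts is built in, so that sums over all intermediate rows keep only
    the admissible ones. *)
Definition row_weight (c : 'I_n) u v : R :=
  if row_counts c.+1 u && row_counts c v then
    \prod_(i < n | (lift ord0 c < lift ord0 i)%N) row_sum (lift ord0 c) u v (lift ord0 i)
  else 0.

Definition row_size (c : 'I_n) : nat :=
  (\sum_(i < n | (lift ord0 c <= lift ord0 i)%N) Nc i)%N.

(** The binomial comes from the uniform subset. The exponent is the number of sites skipped by color
    i + 1, that is of output sites with colors c + 1, ..., i, which depends on the type counts
    only. *)
Definition step_factor (c : 'I_n) : R :=
  'C(N, row_size c)%:R^-1 * \prod_(i < n | (lift ord0 c < lift ord0 i)%N)
    (1 - q ^+ \sum_(j < n | (c <= j < i)%N) Nc j).

Lemma color_lt_row r v p : row_counts r v -> v p != ord0 -> (r < v p)%N.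
Proof.
move=> /row_countsP vr; case: (unliftP ord0 (v p)) => [i vi|->]; last by rewrite eqxx.
rewrite vi => _; rewrite ltnS leqNgt; apply/negP => ir.
have := vr i; rewrite leqNgt ir /= => /eqP; rewrite -leqn0 leqNgt => /negP; apply.
by apply/card_gt0P; exists p; apply/eqP.
Qed.

Lemma row_size_le c : (row_size c <= N)%N.
Proof.
apply: leq_trans Nc_sum; rewrite /row_size [X in (X <= _)%N]big_mkcond /=.
by apply: leq_sum => i _; case: ifP.
Qed.

Lemma step_factor_gt0 c : 0 < step_factor c.
Proof.
rewrite mulr_gt0 ?invr_gt0 ?ltr0n ?bin_gt0 ?row_size_le//.
apply: prodr_gt0 => i ci; rewrite subr_gt0 exprn_ilt1//.
rewrite -lt0n (bigD1 c) ?ltn_addr//=; rewrite leqnn /=.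
by move: ci; rewrite ltnS.
Qed.

Lemma row_size_rec c : row_size c = (Nc c + \sum_(i < n | (c < i)%N) Nc i)%N.
Proof.
rewrite /row_size (bigD1 c)//=; congr addn; apply: eq_bigl => i.
by rewrite /bump !add1n ltnS [RHS]ltn_neqAle andbC -(inj_eq val_inj) eq_sym.
Qed.

Lemma count_queue_color c u i : row_counts c.+1 u ->
  count (fun a => u a == lift ord0 i) (queue (lift ord0 c) u) =
  if (c < i)%N then Nc i else 0%N.
Proof.
move=> ru; rewrite count_queue -(row_countsP _ _ ru i); apply: eq_card => p.
rewrite inE andb_idr// => /eqP up; apply: (color_lt_row ru).
by rewrite up.
Qed.

Lemma size_queue c u : row_counts c.+1 u ->
  (Nc c + size (queue (lift ord0 c) u))%N = row_size c.
Proof.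
move=> ru; rewrite row_size_rec; congr addn.
rewrite -(count_predT (queue _ u)) count_queue.
rewrite [RHS]big_mkcond; under [RHS]eq_bigr do rewrite -(row_countsP _ _ ru).
rewrite card_has_color_sum; apply: eq_card => p; rewrite !inE.
by apply/idP/idP => [|/(color_lt_row ru)//]; rewrite -lt0n; exact: leq_ltn_trans.
Qed.

Lemma entries_queue c u i p : (c < i)%N ->
  entries u (queue (lift ord0 c) u) (lift ord0 i) p = (u p == lift ord0 i).
Proof.
move=> ci; rewrite /entries count_queue.
have [up|up] := eqVneq (u p) (lift ord0 i).
  rewrite -[RHS](card1 p); apply: eq_card => x; rewrite !inE.
  by case: eqP => // ->; rewrite up eqxx.
by apply: eq_card0 => x; rewrite !inE; case: eqP => // ->; rewrite (negPf up).
Qed.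

Lemma fill_row c u J s : row_counts c.+1 u -> #|J| = row_size c ->
  placed J u (queue (lift ord0 c) u) s -> row_counts c (fill (lift ord0 c) J s).
Proof.
move=> ru Jc pl; have [/forallP sJ /forallP cnt] := andP pl.
have cnts i : #|has_color s (lift ord0 i)| = if (c < i)%N then Nc i else 0%N.
  by rewrite (eqP (cnt i)) count_queue_color.
apply/row_countsP => i; have [->|ic] := eqVneq i c.
  rewrite leqnn; apply/eqP; rewrite -(eqn_add2r (size (queue (lift ord0 c) u))).
  rewrite size_queue// -Jc -(card_available pl); last first.
    by apply: sub_all (queue_all _ _) => b; rewrite -lt0n; exact: leq_ltn_trans.
  rewrite eqn_add2r; apply/eqP/eq_card => p.
  rewrite unfold_in /has_color ffunE [RHS]unfold_in -/(available J s p).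
  case: ifP => _; first by rewrite eqxx.
  apply/negP => sp; have := cnts c; rewrite ltnn => /card0_eq/(_ p).
  by rewrite unfold_in /has_color sp.
rewrite leq_eqVlt eq_sym (inj_eq val_inj) (negPf ic) -cnts; apply: eq_card => p.
rewrite unfold_in /has_color ffunE [RHS]unfold_in; case: ifP => // /andP[_ /eqP ->].
by rewrite (inj_eq lift_inj) eq_sym (negPf ic).
Qed.

Definition occupied v : {set 'I_N} := [set p | v p != ord0].

Definition above (m : color n) v : config n N :=
  [ffun p => if (m < v p)%N then v p else ord0].

(** The output of a step determines the random subset and the configuration before filling, so the
    sums over both reduce to one term. *)
Lemma fill_inj c u J s v : row_counts c.+1 u ->
  placed J u (queue (lift ord0 c) u) s ->
  v = fill (lift ord0 c) J s -> J = occupied v /\ s = above (lift ord0 c) v.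
Proof.
move=> ru /andP[/forallP sJ /forallP cnt] ->; split.
  apply/setP => p; rewrite inE ffunE /available; have := sJ p.
  by case: (p \in J) => /=; case: (eqVneq (s p) ord0).
have rs : row_counts c.+1 s.
  by apply/row_countsP => i; rewrite (eqP (cnt i)) count_queue_color.
apply/ffunP => p; rewrite !ffunE; case: (boolP (available J s p)) => [/andP[_ /eqP ->]|_].
  by rewrite ltnn.
by case: ifPn => // nsp; apply: contraNeq nsp => /(color_lt_row rs).
Qed.

Lemma card_occupied c v : row_counts c v -> #|occupied v| = row_size c.
Proof.
move=> rv; have -> : #|occupied v| = #|[pred p | v p != ord0]|.
  by apply: eq_card => p; rewrite !inE.
rewrite -card_has_color_sum /row_size [RHS]big_mkcond; apply: eq_bigr => i _.
by rewrite (row_countsP _ _ rv).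
Qed.

Lemma fill_above c v : row_counts c v ->
  fill (lift ord0 c) (occupied v) (above (lift ord0 c) v) = v.
Proof.
move=> rv; apply/ffunP => p; rewrite !ffunE /available inE ffunE.
case: (eqVneq (v p) ord0) => [->//|vp] /=.
case: ltnP => [|vc]; first by rewrite (negPf vp).
rewrite eqxx; apply/eqP; rewrite -(inj_eq val_inj) eqn_leq vc andbT.
exact: (color_lt_row rv).
Qed.

Lemma placed_above c u v : row_counts c.+1 u -> row_counts c v ->
  placed (occupied v) u (queue (lift ord0 c) u) (above (lift ord0 c) v).
Proof.
move=> ru rv; apply/andP; split; apply/forallP.
  by move=> p; rewrite inE ffunE; case: ifP; rewrite ?eqxx//; case: (v p == _).
move=> i; rewrite count_queue_color//; have [ci|ci] := ltnP c i; apply/eqP.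
  have := row_countsP _ _ rv i; rewrite ltnW// => <-; apply: eq_card => p.
  rewrite unfold_in /has_color ffunE [RHS]unfold_in.
  case: ifPn => // nv; apply/esym; apply: contraNF nv => /eqP ->.
  by rewrite !lift0.
apply: eq_card0 => p; rewrite unfold_in /has_color ffunE; case: ifP => // cv.
by apply: contraTF cv => /eqP ->; rewrite !lift0 ltnS -leqNgt.
Qed.

Lemma skipped_above c v i p : row_counts c v -> (c < i)%N ->
  skipped (occupied v) (above (lift ord0 c) v) (lift ord0 i) p =
  (lift ord0 c <= v p)%N && (v p < lift ord0 i)%N.
Proof.
move=> rv ci; rewrite /skipped inE ffunE.
case: (eqVneq (v p) ord0) => [->//|/(color_lt_row rv) cv].
have -> : (lift ord0 c <= v p)%N by rewrite lift0.
case: (ltnP (lift ord0 c) (v p)) => // vc /=.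
by apply/esym/(leq_ltn_trans vc); rewrite lift0.
Qed.

Lemma card_skipped_above c v i : row_counts c v -> (c < i)%N ->
  #|skipped (occupied v) (above (lift ord0 c) v) (lift ord0 i)| =
  (\sum_(j < n | (c <= j < i)%N) Nc j)%N.
Proof.
move=> rv ci; rewrite (eq_card (fun p => skipped_above p rv ci)) -sum1_card.
rewrite (partition_big v (fun k => (lift ord0 c <= k)%N && (k < lift ord0 i)%N)) //=.
rewrite [LHS]big_mkcond big_ord_recl /= add0n [RHS]big_mkcond; apply: eq_bigr => j _.
rewrite /bump !add1n !ltnS; case: ifP => // cji.
have := row_countsP _ _ rv j; case/andP: (cji) => -> _ <-.
rewrite -sum1_card; apply: eq_bigl => p; rewrite [RHS]unfold_in /has_color andb_idl//.
by move=> /eqP vp; rewrite unfold_in vp lift0 !ltnS.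
Qed.

Lemma uniform_row c J :
  @uniform_subset R N (\sum_(i < n | (lift ord0 c <= lift ord0 i)%N) Nc i) J =
  if #|J| == row_size c then 'C(N, row_size c)%:R^-1 else 0.
Proof. by rewrite /uniform_subset card_draws card_ord. Qed.

(** The only contribution comes from [occupied v] and [above m v]; there [processE] gives the
    one-color sums of the column, and its factors 1 - q^u go into [step_factor]. *)
Lemma mlq_stepE c u v : row_counts c.+1 u ->
  mlq_step q Nc (lift ord0 c) u v = step_factor c * row_weight c u v.
Proof.
move=> ru; rewrite /row_weight ru /=; set m := lift ord0 c.
have sz J : #|J| = row_size c -> (size (queue m u) < #|J|)%N.
  by move=> ->; rewrite -(size_queue ru) -{1}[size _]add0n ltn_add2r.
have procE J s : #|J| = row_size c -> process q m J u s =
    if placed J u (queue m u) s then \prod_(i < n | (m < lift ord0 i)%N)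
      ((1 - q ^+ #|skipped J s (lift ord0 i)|) *
       color_sum q J s u (queue m u) (lift ord0 i))
    else 0.
  by move=> Jc; apply: processE; [|exact: q_lt1|exact: queue_pairwise|
    exact: queue_all|exact: sz].
have summand J s : #|J| = row_size c -> (J, s) != (occupied v, above m v) ->
    process q m J u s * pret R (fill m J s) v = 0.
  move=> Jc Js; rewrite procE//; case: ifP => [pl|_]; last by rewrite mul0r.
  rewrite /pret [_ == _](negbTE _) ?mulr0//; apply: contraNneq Js => vE.
  by have [<- <-] := fill_inj ru pl vE.
have stepE : mlq_step q Nc m u v = if #|occupied v| == row_size c then
    'C(N, row_size c)%:R^-1 * (process q m (occupied v) u (above m v) *
       pret R (fill m (occupied v) (above m v)) v) else 0.
  rewrite /mlq_step /pbind; under eq_bigr => J _ do rewrite uniform_row.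
  rewrite (bigD1 (occupied v))//= [X in _ + X]big1 ?addr0 => [|J Jv].
    case: ifP => [/eqP Jc|_]; last by rewrite mul0r.
    congr (_ * _); rewrite (bigD1 (above m v))//= big1 ?addr0// => s sv.
    by apply: summand => //; rewrite xpair_eqE (negPf sv) andbF.
  case: ifP => [/eqP Jc|_]; last by rewrite mul0r.
  rewrite big1 ?mulr0// => s _; apply: summand => //.
  by rewrite xpair_eqE (negPf Jv).
(* A [v] with wrong type counts does not arise by filling a placed configuration on a subset of the
   right size, so both sides are 0. *)
rewrite stepE; case: (boolP (row_counts c v)) => [rv|nrv]; last first.
  rewrite mulr0; case: ifP => // /eqP Jc; rewrite procE//.
  case: ifP; last by rewrite mul0r mulr0.
  move=> pl; rewrite /pret [_ == _](negbTE _) ?mulr0//.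
  by apply: contraNneq nrv => ->; exact: (fill_row ru Jc pl).
rewrite (card_occupied rv) eqxx fill_above// /pret eqxx mulr1 procE ?(card_occupied rv)//.
rewrite placed_above// /step_factor -mulrA; congr (_ * _).
rewrite -big_split /=; apply: eq_bigr => i mi.
have ci : (c < i)%N by [].
rewrite card_skipped_above//; congr (_ * _); apply: eq_ring_sum => p.
- exact: entries_queue.
- rewrite /has_color ffunE; case: ifPn => // nv.
  apply/esym; apply: contraNF nv => /eqP ->.
  exact: mi.
- exact: skipped_above.
Qed.

Lemma mlq_step_mass c u : row_counts c.+1 u ->
  \sum_v mlq_step q Nc (lift ord0 c) u v = 1.
Proof.
move=> ru; rewrite /mlq_step {1}/pbind exchange_big /=.
under eq_bigr => J _ do rewrite -mulr_sumr.
rewrite (eq_bigr (fun J : {set 'I_N} => if #|J| == row_size c then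
    'C(N, row_size c)%:R^-1 else 0)); last first.
  move=> J _; rewrite uniform_row.
  case: ifP => [/eqP Jc|_]; last by rewrite mul0r.
  rewrite -[RHS]mulr1; congr (_ * _); rewrite exchange_big /=.
  rewrite -[RHS](@process_mass R q n N q_ge0 q_lt1 (lift ord0 c) J u
    (queue (lift ord0 c) u)).
  - apply: eq_bigr => s _; rewrite -mulr_sumr /pret.
    rewrite (bigD1 (fill (lift ord0 c) J s))//= eqxx.
    by rewrite big1 ?addr0 ?mulr1// => v /negPf ->.
  - exact: queue_pairwise.
  - exact: queue_all.
  - by rewrite Jc -(size_queue ru) -{1}[size _]add0n ltn_add2r.
rewrite -big_mkcond sumr_const /= (_ : #|_| = 'C(N, row_size c)).
  by rewrite -[_ *+ _]mulr_natr mulVf// pnatr_eq0 -lt0n bin_gt0 row_size_le.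
rewrite -[in RHS](card_ord N) -card_draws; apply: eq_card => J.
by rewrite inE.
Qed.

End Step.

(** * Sums of products over countable families *)

Section ProductSeries.
Variable R : realType.

Lemma esum_finType (T : finType) (a : T -> \bar R) : (forall x, (0 <= a x)%E) ->
  \esum_(x in [set: T]) a x = (\sum_x a x)%E.
Proof.
move=> a_ge0; have -> : [set: T] = [set` index_enum T].
  by apply/seteqP; split => // x _ /=; rewrite mem_index_enum.
rewrite [LHS](_ : _ = \sum_(x \in [set` index_enum T]) a x)%E.
  by rewrite -fsbig_seq// index_enum_uniq.
have fs : finite_set [set` index_enum T] by exact: finite_finset.
rewrite -esum_fset//.
Qed.

(** Over the box of indices below M the sum factors into partial sums, which converge to the
    right-hand side. Every finite set of indices lies in such a box, so the boxes give the whole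
    sum. *)
Lemma esum_prod_series (H I : finType) (P : pred H) (G : H -> I -> R ^nat) :
  (forall h i k, P h -> 0 <= G h i k) ->
  (forall h i, P h -> cvgn (series (G h i))) ->
  \esum_(x in [set: H * {ffun I -> nat}])
     (if P x.1 then \prod_i G x.1 i (x.2 i) else 0)%:E =
  (\sum_(h | P h) \prod_i limn (series (G h i)))%:E.
Proof.
move=> G_ge0 cG; set g := fun x : H * {ffun I -> nat} =>
  if P x.1 then \prod_i G x.1 i (x.2 i) else 0.
set L := \sum_(h | P h) _.
have g_ge0 x : 0 <= g x.
  by rewrite /g; case: ifP => // Px; apply: prodr_ge0 => i _; exact: G_ge0.
pose box M (y : H * {ffun I -> 'I_M}) := (y.1, [ffun i => nat_of_ord (y.2 i)]).
have box_inj M : injective (@box M).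
  move=> [h f] [h' f'] [-> /ffunP e]; congr pair; apply/ffunP => i.
  by apply: val_inj; have := e i; rewrite !ffunE.
pose S M := \sum_(h | P h) \prod_i series (G h i) M.
have boxE M : \esum_(x in range (@box M)) (g x)%:E = (S M)%:E.
  rewrite esum_image; last by move=> x y _ _; exact: box_inj.
  rewrite esum_finType; last by move=> x; rewrite lee_fin.
  rewrite sumEFin; congr EFin; rewrite /S.
  rewrite [RHS](_ : _ = \sum_(h | P h) \sum_(f : {ffun I -> 'I_M}) \prod_i G h i (f i)).
    rewrite pair_big_dep [RHS]big_mkcond /=; apply: eq_bigr => -[h f] _.
    rewrite andbT /g /=; case: ifP => // _; apply: eq_bigr => i _; by rewrite ffunE.
  apply: eq_bigr => h _; rewrite -(bigA_distr_bigA (fun i (k : 'I_M) => G h i k)).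
  by apply: eq_bigr => i _; rewrite /series /= big_mkord.
have S_le M : S M <= L.
  apply: ler_sum => h Ph; apply: ler_prod => i _; apply/andP; split.
    by apply: sumr_ge0 => k _; exact: G_ge0.
  apply: nondecreasing_cvgn_le; last exact: cG.
  by apply: nondecreasing_series => k _ _; exact: G_ge0.
have cS : S @ \oo --> L.
  apply: cvg_big => [|h Ph]; first exact: add_continuous.
  apply: cvg_big => [|i _]; [exact: mul_continuous|exact: cG].
apply/eqP; rewrite eq_le; apply/andP; split.
  apply: ge_ereal_sup => _ [A [finA _] <-].
  have [M AM] : exists M, A `<=` range (@box M).
    have /finite_seqP[B AB] := finA.
    exists (\max_(x <- B) \max_i (x.2 i))%N.+1 => x.
    rewrite AB /= => xB; have xlt i : (x.2 i < (\max_(x <- B) \max_i (x.2 i))%N.+1)%N.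
      rewrite ltnS; apply: leq_trans
        (@leq_bigmax_seq _ B xpredT (fun x => \max_i (x.2 i))%N x xB isT).
      exact: (@leq_bigmax _ (fun i => x.2 i)).
    exists (x.1, [ffun i => Ordinal (xlt i)]) => //.
    by case: x {xB} xlt => h f xlt; congr pair; apply/ffunP => i; rewrite !ffunE.
  apply: (@le_trans _ _ (S M)%:E); last by rewrite lee_fin.
  rewrite -boxE; apply: esum_ge; exists A => //.
have E_ge M : ((S M)%:E <= \esum_(x in [set: H * {ffun I -> nat}]) (g x)%:E)%E.
  rewrite -boxE esum_mkcond; apply: le_esum => x _.
  by case: ifP; rewrite lee_fin.
move: E_ge; case: (\esum_(x in _) _) => [r| |] E_ge; last 2 first.
- exact: leey.
- by have := E_ge 0%N.
rewrite lee_fin -(cvg_lim _ cS)//; apply: limr_le; first by apply/cvg_ex; exists L.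
by near=> M; have := E_ge M; rewrite lee_fin.
Unshelve. all: by end_near. Qed.

End ProductSeries.

(** * Factorization of the vertex weights *)

Section VertexWeight.
Variables (R : realType) (q : R) (n : nat).
Implicit Types (A C : vtuple n) (k l m : color n) (c i : 'I_n).

Definition mult A i : nat := odflt 0%N (A i).

Definition incoming A k i : nat := (mult A i + (k == lift ord0 i))%N.

Lemma vinc0 A : vinc ord0 A = A.
Proof. by apply/ffunP => i; rewrite ffunE. Qed.

Lemma vdec0 A : vdec ord0 A = A.
Proof. by apply/ffunP => i; rewrite ffunE. Qed.

Lemma vincK k A : vdec k (vinc k A) = A.
Proof.
by apply/ffunP => i; rewrite !ffunE; case: eqP => // _; case: (A i).
Qed.

(** The infinite coordinate of color m absorbs the decrement, so an exit of color m obeys the same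
    rule C = A + e_k - e_l as any other. *)
Lemma vdec_self c k A : vertical_ok (lift ord0 c) A ->
  vdec (lift ord0 c) (vinc k A) = vinc k A.
Proof.
move=> /forallP/(_ c); rewrite ltnn eqxx => /eqP Ac.
by apply/ffunP => i; rewrite !ffunE (inj_eq lift_inj); case: (eqVneq i c) => // ->;
  rewrite Ac; case: ifP.
Qed.

Lemma vsum_mult A i : vsum A (lift ord0 i) (lift ord0 i) = mult A i.
Proof.
rewrite /vsum (eq_bigl (pred1 i)) ?big_pred1_eq// => j.
by rewrite -eqn_leq eq_sym (inj_eq val_inj) (inj_eq lift_inj).
Qed.

(** The entering color counts when it exceeds [l]; this is the origin of the additional 1 in the
    exponents of the weights. *)
Lemma vsum_above A k l :
  (\sum_(i < n | (l < lift ord0 i)%N) incoming A k i)%N = (vsum A l.+1 n + (l < k))%N.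
Proof.
rewrite big_split /=; congr addn.
  by apply: eq_bigl => i; rewrite /bump add1n ltn_ord andbT.
case: (unliftP ord0 k) => [k' ->|->]; last by rewrite ltn0 big1.
under eq_bigr do rewrite (inj_eq lift_inj).
rewrite -big_mkcondr /= sum1dep_card; case: ltnP => lk.
  rewrite (@fintype.eq_card1 _ k')// => i; rewrite !inE eq_sym andbC.
  by case: eqP => // ->.
by rewrite eq_card0// => i; rewrite !inE; case: eqP => [<-|]; rewrite ?andbF//
  andbT ltnNge lk.
Qed.

Lemma prod_site_weight m l (b : 'I_n -> nat) :
  \prod_(i < n | (m < lift ord0 i)%N)
     site_weight q (b i) (l == lift ord0 i) ((m <= l)%N && (l < lift ord0 i)%N) =
  (\prod_(i < n | (m < lift ord0 i)%N && (l == lift ord0 i)) (1 - q ^+ b i)) *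
  (if (m <= l)%N then q ^+ \sum_(i < n | (l < lift ord0 i)%N) b i else 1).
Proof.
rewrite [LHS]big_mkcond /= [X in X * _]big_mkcond /=.
have -> : (if (m <= l)%N then q ^+ \sum_(i < n | (l < lift ord0 i)%N) b i else 1) =
    \prod_(i < n) (if (m <= l)%N && (l < lift ord0 i)%N then q ^+ b i else 1).
  case: ifP => _; last by rewrite big1.
  rewrite big_mkcond /=; elim/big_rec2: _ => [|i x y _ <-]; first by rewrite expr0.
  by case: ifP => _; rewrite ?mul1r ?add0n// exprD.
rewrite -big_split /=; apply: eq_bigr => i _; rewrite /site_weight.
case: (ltnP m (lift ord0 i)) => mi; case: (eqVneq l (lift ord0 i)) => [->|_];
  rewrite ?ltnn ?andbF ?mulr1 ?mul1r//.
case: ifP => // /andP[ml li].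
by have := leq_ltn_trans ml li; rewrite ltnNge mi.
Qed.

(** All cases of the weight become one formula once the entering particle is added to the vertical
    ones: a conservation indicator times a product over colors. For k = l this turns 1 - q^b into 1
    - q^(1+A_k). *)
Lemma waltE c A k C l : vertical_ok (lift ord0 c) A ->
  walt q (lift ord0 c) A k C l =
  ([&& (k == ord0) || (c.+1 < k)%N, (l == ord0) || (c.+1 <= l)%N
     & C == vdec l (vinc k A)])%:R *
  \prod_(i < n | (lift ord0 c < lift ord0 i)%N)
     site_weight q (incoming A k i) (l == lift ord0 i)
       ((lift ord0 c <= l)%N && (l < lift ord0 i)%N).
Proof.
move=> okA; rewrite prod_site_weight vsum_above.
have mE : nat_of_ord (lift ord0 c) = c.+1 by rewrite lift0.
have m0 : (ord0 == lift ord0 c) = false by [].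
move: (lift ord0 c) mE m0 (vdec_self k okA) => m mE m0 mself.
case: (unliftP ord0 l) => [l' le|->]; last first.
  rewrite big_pred0 ?mul1r => [|i]; last by rewrite andbF.
  rewrite [in X in _ * X]mE mulr1 vdec0 /walt eqxx /= m0 !andbF /=.
  case: (eqVneq k ord0) => [->|k0] /=; first by rewrite ?ltn0 vinc0; case: eqP.
  rewrite andbF /= mE.
  by case: ltnP => //= ck; case: eqP.
have [i0 {}le] : exists i0 : 'I_n, l = lift ord0 i0 by exists l'.
have l0 : (l == ord0) = false by rewrite le.
rewrite /walt l0 /= !andbF /=.
case: (ltngtP m l) => [ml|lm|/val_inj ml].
- rewrite -mE (ltnW ml) /= (big_pred1 i0) => [|i]; last first.
    apply/andP/eqP => [[_ /eqP]|->]; first by rewrite le => /lift_inj ->.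
    by split; [move: ml; rewrite le|rewrite le].
  have lm : (l == m) = false by apply/negbTE; rewrite -(inj_eq val_inj) gtn_eqF.
  rewrite lm /= ?andbF ?andbT /= /incoming -le.
  have multE : vsum A l l = mult A i0 by rewrite le vsum_mult.
  rewrite multE.
  case: (eqVneq k ord0) => [->|k0] /=.
    rewrite [ord0 == l]eq_sym l0 vinc0 /= !addn0.
    by case: eqP => _; rewrite ?mul1r ?mul0r.
  case: (ltnP m k) => mk /=; last first.
    by rewrite [(l < k)%N]ltnNge (leq_trans mk (ltnW ml)) /= mul0r.
  have [kl|kl] := eqVneq k l.
    rewrite kl vincK ltnn /= !addn0 add1n addn1 multE.
    by case: eqP => _; rewrite ?mul1r ?mul0r.
  rewrite /= addn0.
  case: ltngtP => [kll|llk|/val_inj klE]; last by rewrite klE eqxx in kl.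
  + by rewrite addn0 /=; case: eqP => _; rewrite ?mul1r ?mul0r.
  + by rewrite addn1 add1n /=; case: eqP => _; rewrite ?mul1r ?mul0r.
- rewrite -mE [(m <= l)%N]leqNgt lm /= !andbF mul0r.
  have lm' : (l == m) = false by apply/negbTE; rewrite -(inj_eq val_inj) ltn_eqF.
  rewrite lm' ?andbF /=.
  case: (ltnP m k) => //= mk; have lk : (l < k)%N := ltn_trans lm mk.
  have -> : (l == k) = false by apply/negbTE; rewrite -(inj_eq val_inj) ltn_eqF.
  by rewrite ltnNge (ltnW lk).
- rewrite -ml -mE leqnn /= mself big_pred0 ?mul1r => [|i]; last first.
    by apply/negbTE/negP => /andP[mi /eqP mE']; move: mi; rewrite mE' ltnn.
  rewrite eqxx andbF /=.
  case: (eqVneq k ord0) => [->|k0] /=.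
    rewrite vinc0 addn0.
    by case: eqP => _; rewrite ?mul1r ?mul0r.
  case: (ltnP m k) => mk /=; last by rewrite mul0r.
  rewrite addn1 add1n; case: eqP => _; rewrite ?mul1r//=.
  have -> : (m == k) = false by apply/negbTE; rewrite -(inj_eq val_inj) ltn_eqF.
  by rewrite ltnNge (ltnW mk) /= mul0r.
Qed.

End VertexWeight.

(** * One column: from vertical tuples to crossing numbers *)

Section Cylinder.
Variables (R : realType) (q : R) (n N : nat) (Nc : 'I_n -> nat).
Variable j0 : 'I_N.
Hypothesis j0E : j0 = 0%N :> nat.
Implicit Types (u v : config n N) (c i : 'I_n) (j : 'I_N).

Definition enters u i : 'I_N -> nat := fun p => u p == lift ord0 i.

Definition skips c v i : pred 'I_N :=
  fun p => (lift ord0 c <= v p)%N && (v p < lift ord0 i)%N.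

Definition ring_weight c u v i : nat -> R :=
  col_weight q (enters u i) (has_color v (lift ord0 i)) (skips c v i) (enum 'I_N).

(** Coordinate of color i + 1 in the vertical tuple at site [k], when the one at site 0 equals
    [a]. *)
Definition ring_height u v i (a k : nat) : nat :=
  col_end (enters u i) (has_color v (lift ord0 i)) (take k (enum 'I_N)) a.

Lemma ring_weightE c u v i a : ring_weight c u v i a =
  \prod_(j < N) site_weight q (ring_height u v i a j + (u j == lift ord0 i))
    (v j == lift ord0 i) (skips c v i j).
Proof.
rewrite /ring_weight (col_weight_nth _ j0).
pose F k := site_weight q (ring_height u v i a k + enters u i (nth j0 (enum 'I_N) k))
   (has_color v (lift ord0 i) (nth j0 (enum 'I_N) k))
   (skips c v i (nth j0 (enum 'I_N) k)).
rewrite -(big_mkord xpredT F) size_enum_ord big_mkord; apply: eq_bigr => j _.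
by rewrite /F nth_ord_enum.
Qed.

Lemma ring_heightS u v i a j :
  ring_height u v i a j.+1 =
  (ring_height u v i a j + (u j == lift ord0 i) - (v j == lift ord0 i))%N.
Proof.
rewrite /ring_height (take_nth j0) ?size_enum_ord// nth_ord_enum -cats1.
by rewrite col_end_cat.
Qed.

Lemma sum_enters u i : (\sum_p enters u i p)%N = #|has_color u (lift ord0 i)|.
Proof.
rewrite -sum1_card [RHS]big_mkcond; apply: eq_bigr => p _.
by rewrite unfold_in /has_color /enters; case: eqP.
Qed.

Lemma big_enum_ord (V : Type) (idx : V) (op : Monoid.com_law idx)
    (P : pred 'I_N) (F : 'I_N -> V) :
  \big[op/idx]_(p <- enum 'I_N | P p) F p = \big[op/idx]_(p | P p) F p.
Proof. by rewrite big_enum_cond; apply: eq_bigl. Qed.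

Lemma val_ordS j : nat_of_ord (ordS j) = if j.+1 == N then 0%N else j.+1.
Proof.
rewrite /=; case: eqP => [->|/eqP jN]; first by rewrite modnn.
by rewrite modn_small// ltn_neqAle jN ltn_ord.
Qed.

(** The content is in the last site: after a full turn the height is back at [a]. The nonzero weight
    excludes truncated subtractions. *)
Lemma ring_height_ordS c u v i a j :
  #|has_color u (lift ord0 i)| = #|has_color v (lift ord0 i)| ->
  ring_weight c u v i a != 0 ->
  ring_height u v i a (ordS j) = ring_height u v i a j.+1.
Proof.
move=> uv nz; rewrite val_ordS; case: eqP => // ->.
rewrite /ring_height take0 take_oversize ?size_enum_ord//=.
apply/eqP; rewrite eq_sym -(eqn_add2r #|has_color v (lift ord0 i)|) -{1}sum1_card.
have := col_end_conserve nz; rewrite -sum1_count !big_enum_ord sum_enters uv => /eqP.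
by [].
Qed.

Definition ring_tuple c u v (a : 'I_n -> nat) (k : nat) : vtuple n :=
  [ffun i : 'I_n => if (i < c)%N then Some 0%N else if i == c then None
             else Some (ring_height u v i (a i) k)].

Lemma vertical_ok_ring_tuple c u v a k : vertical_ok (lift ord0 c) (ring_tuple c u v a k).
Proof.
apply/forallP => i; rewrite ffunE !lift0 ltnS (inj_eq lift_inj).
by case: ltnP => _; rewrite ?eqxx//; case: eqP.
Qed.

Lemma prod_walt_ring_tuple c u v a :
  row_counts Nc c.+1 u -> row_counts Nc c v ->
  \prod_(j < N) walt q (lift ord0 c) (ring_tuple c u v a j) (u j)
                       (ring_tuple c u v a (ordS j)) (v j) =
  \prod_(i < n | (lift ord0 c < lift ord0 i)%N) ring_weight c u v i (a i).
Proof.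
move=> ru rv.
under eq_bigr => j _ do rewrite waltE ?vertical_ok_ring_tuple//.
rewrite big_split /= [X in _ * X]exchange_big /=.
have -> : \prod_(i < n | (bump 0 c < bump 0 i)%N) \prod_(j < N)
     site_weight q (incoming (ring_tuple c u v a j) (u j) i) (v j == lift ord0 i)
       ((bump 0 c <= v j)%N && (v j < bump 0 i)%N) =
   \prod_(i < n | (bump 0 c < bump 0 i)%N) ring_weight c u v i (a i).
  apply: eq_bigr => i ci; rewrite ring_weightE; apply: eq_bigr => j _.
  rewrite /incoming /mult ffunE.
  have {}ci : (c < i)%N by [].
  by rewrite ltnNge ltnW//= -(inj_eq val_inj) gtn_eqF.
(* If the ring weights multiply to 0, both sides vanish. Otherwise every height closes up around the
   ring, so all conservation indicators equal 1. *)
have [->|nz] := eqVneq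
  (\prod_(i < n | (bump 0 c < bump 0 i)%N) ring_weight c u v i (a i)) 0.
  by rewrite mulr0.
rewrite big1 ?mul1r// => j _.
have u_lt : u j != ord0 -> (c.+1 < u j)%N := color_lt_row ru.
have v_lt : v j != ord0 -> (c < v j)%N := color_lt_row rv.
rewrite (_ : _ || _); last by case: eqP u_lt => //= _ ->.
rewrite (_ : _ || _); last by case: eqP v_lt => //= _ ->.
rewrite /= (_ : _ == _)//; apply/eqP/ffunP => i; rewrite !ffunE.
have [ic|ci|/val_inj ->] := ltngtP i c.
- have -> : (lift ord0 i == u j) = false.
    by apply/negP => /eqP ui; move: u_lt; rewrite -ui lift0 ltnS => /(_ isT); lia.
  have -> // : (lift ord0 i == v j) = false.
  by apply/negP => /eqP vi; move: v_lt; rewrite -vi lift0 ltnS => /(_ isT); lia.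
- rewrite -(inj_eq val_inj) gtn_eqF//.
  rewrite (@ring_height_ordS c) ?ring_heightS; last 2 first.
  + by rewrite (row_countsP _ _ _ ru) (row_countsP _ _ _ rv) ci ltnW.
  + by apply: contraNneq nz => rz; rewrite (bigD1 i)//= rz mul0r.
  rewrite [lift ord0 i == u j]eq_sym [lift ord0 i == v j]eq_sym.
  by case: (u j == _); case: (v j == _); rewrite /= ?addn0 ?subn0 ?addn1 ?subn1.
- by rewrite eqxx; case: ifP => _; case: ifP.
Qed.

(** An exit of a color above m from an empty stock has the factor 1 - q^0 = 0, so conservation also
    holds in its additive form, which can be summed over the ring. *)
Lemma walt_neq0 c (A C : vtuple n) (k l : color n) :
  vertical_ok (lift ord0 c) A -> vertical_ok (lift ord0 c) C ->
  walt q (lift ord0 c) A k C l != 0 ->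
  [/\ (k == ord0) || (c.+1 < k)%N, (l == ord0) || (c < l)%N &
   forall i, (c < i)%N ->
     (mult C i = incoming A k i - (l == lift ord0 i) /\
      mult C i + (l == lift ord0 i) = incoming A k i)%N].
Proof.
move=> okA okC; rewrite waltE// mulf_eq0 negb_or pnatr_eq0 eqb0 negbK.
move=> /andP[/and3P[ck cl /eqP CE] nz]; split=> // i ci.
have E : mult C i = (incoming A k i - (l == lift ord0 i))%N.
  rewrite CE /mult /incoming /mult !ffunE.
  have := forallP okA i; rewrite !lift0 ltnS (inj_eq lift_inj) ltnNge ltnW//=.
  rewrite -(inj_eq val_inj) gtn_eqF// => Ai.
  rewrite ![lift ord0 i == _]eq_sym; case: (A i) Ai => // x _.
  by case: (k == _); case: (l == _); rewrite /= ?addn0 ?subn0 ?addn1 ?subn1.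
split=> //; rewrite E subnK//.
case: (eqVneq l (lift ord0 i)) => // li; rewrite lt0n; apply: contraNneq nz => b0.
apply/eqP; rewrite (bigD1 i)//= b0 li eqxx.
by rewrite /site_weight expr0 subrr mul0r.
Qed.

(** Summing conservation over the ring cancels the vertical multiplicities, so [u] inherits the
    counts of [v]; following it from site 0 recovers all tuples from the one at [j0]. *)
Lemma ring_conserve c u v (A : 'I_N -> vtuple n) :
  (forall j, vertical_ok (lift ord0 c) (A j)) -> row_counts Nc c v ->
  \prod_(j < N) walt q (lift ord0 c) (A j) (u j) (A (ordS j)) (v j) != 0 ->
  row_counts Nc c.+1 u /\
  forall j, A j = ring_tuple c u v (mult (A j0)) j.
Proof.
move=> okA rv nz.
have W j : walt q (lift ord0 c) (A j) (u j) (A (ordS j)) (v j) != 0.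
  by apply: contraNneq nz => wz; rewrite (bigD1 j)//= wz mul0r.
have wj j := walt_neq0 (okA j) (okA (ordS j)) (W j).
split.
  apply/row_countsP => i; case: ltnP => ci; last first.
    apply: eq_card0 => p; apply/negP => /eqP up; have [+ _ _] := wj p.
    by rewrite up lift0 ltnS ltnNge ci.
  have := row_countsP _ _ _ rv i; rewrite ltnW// => <-; rewrite -!sum_enters.
  apply/eqP; rewrite -(eqn_add2l (\sum_j mult (A j) i)) -big_split /=.
  rewrite [X in _ == (X + _)%N](reindex_inj (@ordS_inj N)) /= -big_split /=; apply/eqP.
  by apply: eq_bigr => p _; have [_ _ /(_ i ci)[_ ->]] := wj p.
move=> j; apply/ffunP => i; rewrite ffunE; have := forallP (okA j) i.
rewrite !lift0 ltnS (inj_eq lift_inj) -[i == c](inj_eq val_inj) /=.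
case: ltngtP => [_ /eqP//|ci Ai|_ /eqP//].
rewrite -(_ : mult (A j) i = ring_height u v i (mult (A j0) i) j); first by
  rewrite /mult; case: (A j i) Ai.
case: j {Ai} => k kN; elim: k kN => [|k IH] kN.
  by rewrite /ring_height take0 /=; congr (mult (A _) _); apply: val_inj.
have kN' := ltnW kN; rewrite [nat_of_ord _]/=.
have -> : Ordinal kN = ordS (Ordinal kN').
  by apply: val_inj; rewrite /= modn_small.
have [_ _ /(_ i ci)[-> _]] := wj (Ordinal kN').
by rewrite (ring_heightS u v i _ (Ordinal kN')) /= -(IH kN').
Qed.

End Cylinder.

(** * The cylinder partition function *)

Section PartitionFunction.
Variables (R : realType) (q : R) (n N : nat) (Nc : 'I_n -> nat).
Hypotheses (q_ge0 : 0 <= q) (q_lt1 : q < 1) (Nc_ge1 : forall i : 'I_n, (1 <= Nc i)%N)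
  (N_gt0 : (0 < N)%N).
Implicit Types (c i : 'I_n) (j : 'I_N) (h : {ffun 'I_n.+1 -> config n N}).

Let j0 : 'I_N := Ordinal N_gt0.

Definition row_left c h : config n N := h (lift ord0 c).
Definition row_right c h : config n N := h (widen_ord (leqnSn n) c).

Definition rows_ok h : bool := [forall r : 'I_n.+1, row_counts Nc r (h r)].

Lemma rows_ok_left c h : rows_ok h -> row_counts Nc c.+1 (row_left c h).
Proof. by move=> /forallP/(_ (lift ord0 c)); rewrite lift0. Qed.

Lemma rows_ok_right c h : rows_ok h -> row_counts Nc c (row_right c h).
Proof. by move=> /forallP/(_ (widen_ord (leqnSn n) c)). Qed.

(* A state of the cylinder with nonzero weight is determined by its rows and by
   the number of particles of each color crossing site 0 in each column. *)
Definition state_of (y : {ffun 'I_n.+1 -> config n N} * {ffun 'I_n * 'I_n -> nat}) :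
    cyl_state n N :=
  (y.1, [ffun c => [ffun j : 'I_N => ring_tuple c (row_left c y.1) (row_right c y.1)
                             (fun i => y.2 (c, i)) j]]).

Lemma cyl_weight_state_of y : rows_ok y.1 ->
  cyl_weight q (state_of y) = \prod_(c < n) \prod_(i < n | (lift ord0 c < lift ord0 i)%N)
    ring_weight q c (row_left c y.1) (row_right c y.1) i (y.2 (c, i)).
Proof.
move=> ok; apply: eq_bigr => c _.
rewrite -(@prod_walt_ring_tuple R q n N Nc j0 erefl c _ _ _
  (rows_ok_left c ok) (rows_ok_right c ok)).
by apply: eq_bigr => j _; rewrite !ffunE.
Qed.

(** Entries for colors up to that of the column are not read by [state_of]; fixing them at 0 makes
    it injective. *)
Definition reduced (y : {ffun 'I_n.+1 -> config n N} * {ffun 'I_n * 'I_n -> nat}) :=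
  forall c i, ~~ (c < i)%N -> y.2 (c, i) = 0%N.

Lemma state_of_inj y y' : reduced y -> reduced y' -> state_of y = state_of y' -> y = y'.
Proof.
case: y y' => [h a] [h' a'] ry ry' E; have [hh /ffunP E2] := E; congr pair => //.
apply/ffunP => -[c i]; have [ci|ci] := boolP (c < i)%N; last by rewrite ry// ry'.
have /ffunP/(_ j0)/ffunP/(_ i) := E2 c; rewrite !ffunE /ring_height /= !take0 /=.
by rewrite ltnNge ltnW//= -(inj_eq val_inj) gtn_eqF//= => -[].
Qed.

(** Column by column, conservation carries the type counts from the right boundary [eta] to the rows
    on its left. *)
Lemma cyl_weight_neq0 eta x : row_counts Nc 0 eta -> cyl_admissible eta x ->
  cyl_weight q x != 0 ->
  exists y, [/\ rows_ok y.1, reduced y & x = state_of y].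
Proof.
case: x => h V r0 [/= hmax h0 okV] nz.
have W c : \prod_(j < N) walt q (lift ord0 c) (V c j) (row_left c h j)
    (V c (ordS j)) (row_right c h j) != 0.
  by apply: contraNneq nz => wz; rewrite /cyl_weight (bigD1 c)//= wz mul0r.
have cons c u v := @ring_conserve R q n N Nc j0 erefl c u v (V c) (okV c).
have ok : rows_ok h.
  apply/forallP => -[r rn]; elim: r rn => [|r IH] rn.
    by rewrite (_ : Ordinal rn = ord0) ?h0//; apply: val_inj.
  have rn' : (r < n)%N by [].
  have rr : row_counts Nc r (row_right (Ordinal rn') h).
    by rewrite /row_right (_ : widen_ord _ _ = Ordinal (ltnW rn)) ?IH//; apply: val_inj.
  have [+ _] := cons (Ordinal rn') _ _ rr (W (Ordinal rn')).
  by rewrite /row_left (_ : lift _ _ = Ordinal rn)//; apply: val_inj.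
pose a := [ffun ci : 'I_n * 'I_n =>
  if (ci.1 < ci.2)%N then mult (V ci.1 j0) ci.2 else 0%N].
exists (h, a); split=> //; first by move=> c i ci; rewrite ffunE /= (negPf ci).
congr pair; apply/ffunP => c; apply/ffunP => j; rewrite !ffunE /=.
have [_ ->] := cons c _ _ (rows_ok_right c ok) (W c).
apply/ffunP => i; rewrite !ffunE /=; case: (ltngtP i c) => [//|ci|/val_inj ->].
  by [].
by rewrite eqxx.
Qed.

Definition chains eta : pred {ffun 'I_n.+1 -> config n N} := fun h =>
  [&& rows_ok h, h ord_max == empty_config n N & h ord0 == eta].

(** The indicator has sum 1 and extends the family to all pairs, so that the index set is a full
    product. *)
Definition crossing_weight h (ci : 'I_n * 'I_n) (t : nat) : R :=
  if (ci.1 < ci.2)%N then ring_weight q ci.1 (row_left ci.1 h) (row_right ci.1 h) ci.2 t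
  else (t == 0%N)%:R.

Lemma crossing_weight_ge0 h ci t : 0 <= crossing_weight h ci t.
Proof. by rewrite /crossing_weight; case: ifP => // _; exact: col_weight_ge0. Qed.

Lemma series_indicator0 : series (fun t : nat => (t == 0%N)%:R : R) @ \oo --> (1 : R).
Proof.
rewrite -(cvg_shiftS (series _)) (_ : [sequence _]_n = fun=> 1); first exact: cvg_cst.
by apply/funext => k; rewrite /series /= big_nat_recl//= big1 ?addr0.
Qed.

Lemma is_cvg_crossing_weight h ci : rows_ok h -> cvgn (series (crossing_weight h ci)).
Proof.
case: ci => c i ok; rewrite /crossing_weight /=.
case: ltnP => ci; last by apply/cvg_ex; exists 1; exact: series_indicator0.
(* Color c + 1 occurs in the right row because its count is positive, and it is skipped by every
   higher color: this gives convergence. *)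
apply: is_cvg_col_weight => //; have := row_countsP _ _ _ (rows_ok_right c ok) c.
rewrite leqnn => cnt.
have /card_gt0P[p] : (0 < #|has_color (row_right c h) (lift ord0 c)|)%N.
  by rewrite cnt.
rewrite unfold_in => /eqP pc; apply/hasP; exists p; first by rewrite mem_enum.
rewrite /skips /has_color pc leqnn (inj_eq lift_inj) -(inj_eq val_inj) /=.
by rewrite /bump !add1n ltnS ci ltn_eqF.
Qed.

Lemma lim_crossing_weight h c : \prod_(i < n) limn (series (crossing_weight h (c, i))) =
  \prod_(i < n | (lift ord0 c < lift ord0 i)%N)
     row_sum q (lift ord0 c) (row_left c h) (row_right c h) (lift ord0 i).
Proof.
rewrite [RHS]big_mkcond; apply: eq_bigr => i _; rewrite /crossing_weight /=.
rewrite /bump !add1n ltnS; case: ltnP => // _.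
by apply/cvg_lim => //; exact: series_indicator0.
Qed.

Lemma prod_pair (I J : finType) (F : I * J -> R) :
  \prod_p F p = \prod_i \prod_j F (i, j).
Proof. by rewrite pair_bigA; apply: eq_bigr => -[]. Qed.

(** States of nonzero weight are the images under [state_of] of reduced data; after this reindexing
    the sum is one of products of one-color series. *)
Lemma FaltE eta : row_counts Nc 0 eta ->
  Falt q eta = (\sum_(h | chains eta h)
    \prod_(c < n) row_weight q Nc c (row_left c h) (row_right c h))%:E.
Proof.
move=> r0.
transitivity (\sum_(h | chains eta h)
    \prod_ci limn (series (crossing_weight h ci)))%:E; last first.
  congr EFin; apply: eq_bigr => h /and3P[ok _ _].
  rewrite prod_pair.
  apply: eq_bigr => c _; rewrite lim_crossing_weight /row_weight.
  by rewrite rows_ok_left// rows_ok_right.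
rewrite -esum_prod_series; last 2 first.
- by move=> h ci t _; exact: crossing_weight_ge0.
- by move=> h ci /and3P[ok _ _]; exact: is_cvg_crossing_weight.
pose P := [set y : {ffun 'I_n.+1 -> config n N} * {ffun 'I_n * 'I_n -> nat} |
  chains eta y.1 /\ reduced y].
transitivity (\esum_(x in state_of @` P) (cyl_weight q x)%:E).
  rewrite /Falt esum_mkcond [RHS]esum_mkcond; apply: eq_esum => x _.
  have [xP|xP] := boolP (x \in state_of @` P).
    have [y [/and3P[ok /eqP ymax /eqP y0] ry] yx] := set_mem xP.
    rewrite mem_set// -yx; split=> //= c j.
    by rewrite !ffunE; exact: vertical_ok_ring_tuple.
  case: ifPn => // /set_mem xA; congr EFin; apply/eqP; apply: contraNT xP => nz.
  have [y [ok ry xE]] := cyl_weight_neq0 r0 xA nz.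
  apply/mem_set; exists y => //; split=> //; case: xA => xmax x0 _.
  by rewrite /chains ok; move: xmax x0; rewrite xE /= => -> ->; rewrite !eqxx.
rewrite esum_image; last first.
  by move=> y y' /set_mem[_ ry] /set_mem[_ ry']; exact: state_of_inj.
rewrite esum_mkcond; apply: eq_esum => y _.
have [yP|yP] := boolP (y \in P).
  have [ch ry] := set_mem yP; rewrite ch; have /and3P[ok _ _] := ch.
  rewrite cyl_weight_state_of//; congr EFin.
  rewrite prod_pair.
  apply: eq_bigr => c _; rewrite big_mkcond /=; apply: eq_bigr => i _.
  rewrite /crossing_weight /bump !add1n ltnS /=.
  by case: ifPn => // ci; rewrite ry.
case: ifP => // ch; congr EFin; apply/esym/eqP; apply: contraNT yP => nz.
apply/mem_set; split=> // c i ci; apply: contraNeq nz => yci.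
by rewrite (bigD1 (c, i))//= /crossing_weight /= (negPf ci) (negPf yci) mul0r.
Qed.

End PartitionFunction.

(** * Composition of the columns *)

Lemma foldl_map (A B C : Type) (f : C -> B -> C) (g : A -> B) (z : C) (s : seq A) :
  foldl f z (map g s) = foldl (fun x y => f x (g y)) z s.
Proof. by elim: s z => /=. Qed.

Section Chains.
Variables (R : realType) (T : finType).

(** Expansion over trajectories, written against time: [h ord_max] is the initial state and [h ord0]
    the final one, as for the rows of the cylinder. *)
Lemma foldl_pbindE n (K : 'I_n -> T -> fpmf R T) (x0 y : T) :
  foldl (fun mu i => pbind mu (K i)) (pret R x0) (rev (enum 'I_n)) y =
  \sum_(h : {ffun 'I_n.+1 -> T} | (h ord_max == x0) && (h ord0 == y))
    \prod_(i < n) K i (h (lift ord0 i)) (h (widen_ord (leqnSn n) i)).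
Proof.
elim: n K y => [|n IH] K y.
  rewrite enum_ord0 /= /pret (eq_bigr (fun=> 1)) => [|h _]; last by rewrite big_ord0.
  have hE (h : {ffun 'I_1 -> T}) : h ord_max = h ord0 by congr (h _); apply: val_inj.
  have [->|yx] := eqVneq y x0.
    rewrite (big_pred1 [ffun=> x0])// => h /=; rewrite hE andbb.
    apply/eqP/eqP => [hx|->]; last by rewrite ffunE.
    by apply/ffunP => i; rewrite ffunE ord1.
  rewrite big_pred0// => h; rewrite hE; apply/negbTE/andP => -[/eqP -> /eqP xy].
  by rewrite xy eqxx in yx.
rewrite enum_ordSl rev_cons -map_rev foldl_rcons foldl_map.
(* The step of index 0 is performed last; [ext] adds its outcome [y] to a trajectory of the other
   steps. *)
pose ext (h : {ffun 'I_n.+1 -> T}) : {ffun 'I_n.+2 -> T} :=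
  [ffun r => if unlift ord0 r is Some r' then h r' else y].
have ext0 h : ext h ord0 = y by rewrite ffunE unlift_none.
have extS h r : ext h (lift ord0 r) = h r by rewrite ffunE liftK.
rewrite [RHS](reindex_onto ext (fun h => [ffun r => h (lift ord0 r)])); last first.
  move=> h /andP[_ /eqP h0]; apply/ffunP => r; case: (unliftP ord0 r) => [r' ->|->].
    by rewrite extS ffunE.
  by rewrite ext0.
rewrite [in LHS]/pbind.
transitivity (\sum_(h : {ffun 'I_n.+1 -> T} | h ord_max == x0)
    (\prod_(i < n) K (lift ord0 i) (h (lift ord0 i)) (h (widen_ord (leqnSn n) i))) *
    K ord0 (h ord0) y).
  rewrite [RHS](partition_big (fun h : {ffun 'I_n.+1 -> T} => h ord0) predT)//=.
  apply: eq_bigr => t _; rewrite (IH (fun i => K (lift ord0 i))) mulr_suml.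
  by apply: eq_bigr => h /andP[_ /eqP ->].
apply: eq_big => h.
  have -> : ord_max = lift ord0 ord_max :> 'I_n.+2 by apply: val_inj.
  rewrite extS ext0 eqxx andbT andb_idr// => _; apply/eqP/ffunP => r.
  by rewrite ffunE extS.
move=> _; rewrite big_ord_recl mulrC extS.
have -> : widen_ord (leqnSn n.+1) ord0 = ord0 by apply: val_inj.
rewrite ext0; congr (_ * _); apply: eq_bigr => i _; rewrite extS.
have -> : widen_ord (leqnSn n.+1) (lift ord0 i) = lift ord0 (widen_ord (leqnSn n) i).
  by apply: val_inj.
by rewrite extS.
Qed.

End Chains.

Lemma foldl_rev_enum_ind (A B : Type) n (P : nat -> A -> B -> Prop)
    (f : A -> 'I_n -> A) (g : B -> 'I_n -> B) (a : A) (b : B) :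
  P n a b -> (forall (i : 'I_n) a b, P i.+1 a b -> P i (f a i) (g b i)) ->
  P 0%N (foldl f a (rev (enum 'I_n))) (foldl g b (rev (enum 'I_n))).
Proof.
elim: n P f g => [|n IH] P f g Pab Pfg; first by rewrite enum_ord0.
rewrite enum_ordSl rev_cons -map_rev !foldl_rcons !foldl_map.
apply: (Pfg ord0); apply: (IH (fun r => P r.+1) (fun a i => f a (lift ord0 i))
  (fun b i => g b (lift ord0 i))) => // i a' b' Pab'.
by apply: (Pfg (lift ord0 i)); rewrite lift0.
Qed.

(** * Comparison of the algorithm with the cylinder *)

Section Law.
Variables (R : realType) (q : R) (n N : nat) (Nc : 'I_n -> nat).
Hypotheses (q_ge0 : 0 <= q) (q_lt1 : q < 1) (Nc_ge1 : forall i : 'I_n, (1 <= Nc i)%N)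
  (Nc_sum : (\sum_(i < n) Nc i <= N)%N) (N_gt0 : (0 < N)%N).

Definition chain_weight : config n N -> R :=
  foldl (fun nu i => pbind nu (row_weight q Nc i)) (pret R (empty_config n N))
        (rev (enum 'I_n)).

Lemma row_counts_empty v : row_counts Nc n v = (v == empty_config n N).
Proof.
apply/row_countsP/eqP => [cnt|-> i].
  apply/ffunP => p; rewrite ffunE; case: (unliftP ord0 (v p)) => // i vi.
  have := cnt i; rewrite leqNgt ltn_ord /= => /card0_eq/(_ p).
  by rewrite unfold_in /has_color vi eqxx.
by rewrite leqNgt ltn_ord; apply: eq_card0 => p; rewrite unfold_in /has_color ffunE.
Qed.

(** Support, mass and proportionality are carried together: mass and proportionality of a step are
    known only for inputs with the right type counts, and the support condition removes the
    others. *)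
Lemma alt_mlq_chain_weight :
  [/\ forall v : config n N, ~~ row_counts Nc 0 v -> alt_mlq q Nc v = 0,
      \sum_(v : config n N) alt_mlq q Nc v = 1 &
      exists2 k : R, 0 < k &
        forall v : config n N, row_counts Nc 0 v -> alt_mlq q Nc v = k * chain_weight v].
Proof.
apply: (@foldl_rev_enum_ind _ _ n (fun r (mu nu : fpmf R (config n N)) =>
  [/\ forall v, ~~ row_counts Nc r v -> mu v = 0, \sum_v mu v = 1 &
      exists2 k : R, 0 < k & forall v, row_counts Nc r v -> mu v = k * nu v])).
  split=> [v||].
  - by rewrite row_counts_empty /pret => /negPf ->.
  - rewrite (bigD1 (empty_config n N))//= /pret eqxx big1 ?addr0// => v.
    by move=> /negPf ->.
  - by exists 1 => // v _; rewrite mul1r.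
move=> c mu nu [mu0 mu1 [k k_gt0 muE]]; split=> [v nv||].
- rewrite /pbind big1// => u _; have [ru|/mu0->] := boolP (row_counts Nc c.+1 u).
    by rewrite mlq_stepE// /row_weight (negPf nv) andbF !mulr0.
  by rewrite mul0r.
- rewrite -[RHS]mu1 exchange_big /=; apply: eq_bigr => u _; rewrite -mulr_sumr.
  have [ru|/mu0->] := boolP (row_counts Nc c.+1 u); last by rewrite mul0r.
  by rewrite mlq_step_mass// mulr1.
- exists (k * step_factor q N Nc c); first by rewrite mulr_gt0// step_factor_gt0.
  move=> v rv; rewrite /pbind mulr_sumr; apply: eq_bigr => u _.
  have [ru|nu0] := boolP (row_counts Nc c.+1 u); last first.
    by rewrite mu0// /row_weight (negPf nu0) /= mul0r !mulr0.
  by rewrite mlq_stepE// muE//; ring.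
Qed.

(** The trajectory expansion also contains rows with wrong counts; one of their [row_weight] factors
    is 0. *)
Lemma Falt_chain_weight eta : row_counts Nc 0 eta -> Falt q eta = (chain_weight eta)%:E.
Proof.
move=> r0; rewrite (FaltE q_ge0 q_lt1 Nc_ge1 N_gt0)// /chain_weight foldl_pbindE.
congr EFin.
rewrite [RHS](bigID (rows_ok Nc)) /= [X in _ + X]big1 ?addr0 => [|h].
  by apply: eq_bigl => h; rewrite /chains andbC.
move=> /andP[/andP[/eqP hmax /eqP h0] nok]; apply/eqP; apply: contraNT nok => nz.
have W (c : 'I_n) : row_counts Nc c.+1 (row_left c h) && row_counts Nc c (row_right c h).
  have : row_weight q Nc c (row_left c h) (row_right c h) != 0.
    by apply: contraNneq nz => wz; rewrite (bigD1 c)//= wz mul0r.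
  by rewrite /row_weight; case: ifP => //; rewrite eqxx.
apply/forallP => r; case: (unliftP ord0 r) => [c ->|->]; last by rewrite h0.
by have /andP[] := W c; rewrite lift0.
Qed.

End Law.

Theorem proposition4p12 (R : realType) (n N : nat) (q : R) (Nc : 'I_n -> nat)
    (n_ge1 : (1 <= n)%N) (N_ge2 : (2 <= N)%N) (q_ge0 : 0 <= q) (q_lt1 : q < 1)
    (Nc_ge1 : forall i : 'I_n, (1 <= Nc i)%N)
    (Nc_sum : (\sum_(i < n) Nc i <= N)%N) :
  [/\ (forall eta : config n N, has_type_counts Nc eta ->
         Falt q eta \is a fin_num),
      0 < \sum_(eta : config n N | has_type_counts Nc eta) fine (Falt q eta) &
      forall eta : config n N, has_type_counts Nc eta ->
        alt_mlq q Nc eta =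
          fine (Falt q eta) /
          \sum_(eta' : config n N | has_type_counts Nc eta')
             fine (Falt q eta')].
Proof.
have N_gt0 : (0 < N)%N by exact: ltnW.
have countsE (eta : config n N) : has_type_counts Nc eta = row_counts Nc 0 eta.
  apply: eq_forallb => i; congr (_ == _); apply: eq_card => p.
  by rewrite inE.
have FE (eta : config n N) : has_type_counts Nc eta ->
    Falt q eta = (chain_weight q Nc eta)%:E.
  by rewrite countsE; exact: Falt_chain_weight.
have [mlq0 mlq1 [k k_gt0 mlqE]] := alt_mlq_chain_weight q_ge0 q_lt1 Nc_ge1 Nc_sum.
(* The total mass 1 determines [k] as the inverse of the sum of partition functions, and also shows
   this sum to be positive. *)
have sumF : k * \sum_(eta : config n N | has_type_counts Nc eta) fine (Falt q eta) = 1.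
  rewrite -mlq1 mulr_sumr big_mkcond /=; apply: eq_bigr => eta _.
  case: ifPn => eta_ok; last by rewrite mlq0// -countsE.
  by rewrite FE//= mlqE// -countsE.
have sum_gt0 : 0 < \sum_(eta : config n N | has_type_counts Nc eta) fine (Falt q eta).
  by rewrite -(pmulr_rgt0 _ k_gt0) sumF.
split=> // eta eta_ok; first by rewrite FE.
apply: (canRL (mulfK _)); first by rewrite gt_eqF.
by rewrite mlqE -?countsE// FE//= mulrAC sumF mul1r.
Qed.
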